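(* (The Laurent phenomenon.) For a seed $\mathbf{s}=(e_i)_{i\in I}$, let $q\in M^\circ$ (resp. $q\in N$) have non-negative pairing with each $e_i$ (resp. each $-v_i$) for $i\in I_{\mathrm{uf}}$. Equivalently, $z^q$ is a monomial which is a regular function on the toric variety $\mathrm{TV}_{\mathbf{s},\mathcal{A}}$ (resp. $\mathrm{TV}_{\mathbf{s},\mathcal{X}}$). Then $z^q$ is a Laurent polynomial on every seed torus, i.e., $z^q\in H^0(\mathcal{A},\mathcal{O}_{\mathcal{A}})$ (resp. $z^q\in H^0(\mathcal{X},\mathcal{O}_{\mathcal{X}})$).
   Context: We work over a field $\Bbbk$ of characteristic zero. For a lattice $L$, $T_L=L\otimes\mathbb{G}_m=\operatorname{Spec}\Bbbk[L^*]$, and $z^m$ denotes the character of $m\in L^*$. For $r\in\mathbb{Q}$, $[r]_+=\max(0,r)$. Fixed data: a lattice $N$ with a skew-symmetric bilinear form $\{\cdot,\cdot\}:N\times N\to\mathbb{Q}$; a saturated sublattice $N_{\mathrm{uf}}\subseteq N$; an index set $I$ with $|I|=\operatorname{rank}N$ and a subset $I_{\mathrm{uf}}$ with $|I_{\mathrm{uf}}|=\operatorname{rank}N_{\mathrm{uf}}$; positive integers $d_i$, $i\in I$, with greatest common divisor 1; a finite index sublattice $N^\circ\subseteq N$ with $\{N_{\mathrm{uf}},N^\circ\}\subseteq\mathbb{Z}$ and $\{N,N_{\mathrm{uf}}\cap N^\circ\}\subseteq\mathbb{Z}$; $M=\operatorname{Hom}(N,\mathbb{Z})$, $M^\circ=\operatorname{Hom}(N^\circ,\mathbb{Z})$.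 A seed is $\mathbf{s}=(e_i)_{i\in I}$, a basis of $N$ such that $\{e_i\}_{i\in I_{\mathrm{uf}}}$ is a basis of $N_{\mathrm{uf}}$ and $\{d_ie_i\}_{i\in I}$ is a basis of $N^\circ$. Put $\epsilon_{ij}=\{e_i,e_j\}d_j$, $[n,e_k]=\{n,e_k\}d_k$, $v_i=\{e_i,\cdot\}\in M^\circ$ for $i\in I_{\mathrm{uf}}$ (one has $d_iv_i\in M$), and let $\langle\cdot,\cdot\rangle:N\times M^\circ\to\mathbb{Q}$ be the canonical pairing. For $k\in I_{\mathrm{uf}}$ the mutated seed $\mu_k(\mathbf{s})=(e_i')$ is $e_k'=-e_k$, $e_i'=e_i+[\epsilon_{ik}]_+e_k$ for $i\ne k$. Seed tori: $\mathcal{X}_{\mathbf{s}}=T_M=\operatorname{Spec}\Bbbk[N]$, $\mathcal{A}_{\mathbf{s}}=T_{N^\circ}=\operatorname{Spec}\Bbbk[M^\circ]$. Mutations are the birational maps $\mathcal{X}_{\mathbf{s}}\dashrightarrow\mathcal{X}_{\mu_k(\mathbf{s})}$, $\mathcal{A}_{\mathbf{s}}\dashrightarrow\mathcal{A}_{\mu_k(\mathbf{s})}$ given by $\mu_k^*z^n=z^n(1+z^{e_k})^{-[n,e_k]}$ ($n\in N$) and $\mu_k^*z^m=z^m(1+z^{v_k})^{-\langle d_ke_k,m\rangle}$ ($m\in M^\circ$). $\mathfrak{T}$ is the oriented rooted tree with $|I_{\mathrm{uf}}|$ outgoing edges at each vertex, labelled by $I_{\mathrm{uf}}$; the root carries the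 seed $\mathbf{s}$, and if an edge labelled $k$ goes from $w$ to $w'$ then $\mathbf{s}_{w'}=\mu_k(\mathbf{s}_w)$. For vertices $w,w'$, composing mutations (or inverses, for edges traversed against orientation) along the simple path from $w$ to $w'$ gives birational maps $\mu_{w,w'}$ between seed tori. The schemes $\mathcal{X},\mathcal{A}$ are obtained by gluing all seed tori $\mathcal{X}_{\mathbf{s}_w}$, resp. $\mathcal{A}_{\mathbf{s}_w}$ (one per vertex), via the $\mu_{w,w'}$, along the largest open subsets on which these are isomorphisms onto open images. The function $z^q$ is the character $z^q$ on the root torus $\mathcal{A}_{\mathbf{s}}$ (resp. $\mathcal{X}_{\mathbf{s}}$), viewed as a rational function on the glued scheme. $\mathrm{TV}_{\mathbf{s},\mathcal{A}}$ is the toric variety of the fan $\{0\}\cup\{\mathbb{R}_{\ge0}d_ie_i: i\in I_{\mathrm{uf}}\}$ in $N^\circ$, and $\mathrm{TV}_{\mathbf{s},\mathcal{X}}$ that of the fan $\{0\}\cup\{-\mathbb{R}_{\ge0}d_iv_i: i\in I_{\mathrm{uf}}\}$ in $M$. *)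

(* Defs.v *)
From mathcomp Require Import all_boot all_order all_algebra.
From mathcomp Require Import mpoly.
From mathcomp Require Import reals.

Set Implicit Arguments.
Unset Strict Implicit.
Unset Printing Implicit Defensive.

Import Order.TTheory GRing.Theory Num.Theory.
Local Open Scope ring_scope.

(* Lattices.  The lattice N is Z^n = 'rV[int]_n and the index set I is 'I_n.  *)

Definition sublattice n (P : 'rV[int]_n -> Prop) : Prop :=
  P 0 /\ (forall x y, P x -> P y -> P (x - y)).

Definition saturated n (P : 'rV[int]_n -> Prop) : Prop :=
  forall (a : int) x, a != 0 -> P (a *: x) -> P x.

Definition finite_index n (P : 'rV[int]_n -> Prop) : Prop :=
  exists s : seq 'rV[int]_n, forall x, exists2 r, r \in s & P (x - r).

Definition is_basis n (J : {set 'I_n}) (b : 'I_n -> 'rV[int]_n)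
    (P : 'rV[int]_n -> Prop) : Prop :=
  [/\ forall i, i \in J -> P (b i),
      forall x, P x -> exists c : 'I_n -> int, x = \sum_(i in J) c i *: b i
    & forall c : 'I_n -> int, \sum_(i in J) c i *: b i = 0 ->
        forall i, i \in J -> c i = 0].

Record fixed_data (n : nat) := FixedData {
  form : 'rV[int]_n -> 'rV[int]_n -> rat;
  Nuf : 'rV[int]_n -> Prop;
  No : 'rV[int]_n -> Prop;
  Iuf : {set 'I_n};
  dd : 'I_n -> nat;
  form_linearl : forall (a : int) x y z,
    form (a *: x + y) z = a%:~R * form x z + form y z;
  form_linearr : forall (a : int) x y z,
    form z (a *: x + y) = a%:~R * form z x + form z y;
  form_skew : forall x y, form x y = - form y x;
  Nuf_sublattice : sublattice Nuf;
  Nuf_saturated : saturated Nuf;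
  (* rank Nuf = #|Iuf| *)
  Nuf_rank : exists b, is_basis Iuf b Nuf;
  dd_gt0 : forall i, (0 < dd i)%N;
  dd_gcd : \big[gcdn/0%N]_(i < n) dd i = 1%N;
  No_sublattice : sublattice No;
  No_finite_index : finite_index No;
  form_Nuf_No : forall x y, Nuf x -> No y -> form x y \is a Num.int;
  form_N_NufNo : forall x y, Nuf y -> No y -> form x y \is a Num.int
}.

Definition is_seed n (D : fixed_data n) (e : 'I_n -> 'rV[int]_n) : Prop :=
  [/\ is_basis setT e (fun _ => True),
      is_basis (Iuf D) e (Nuf D)
    & is_basis setT (fun i => (dd D i)%:Z *: e i) (No D)].

(* M = Hom(N, Z) and Mo = Hom(No, Z) are viewed inside Hom(N, Q) = 'rV[rat]_n;
   for Mo this uses that No has finite index in N.  [pairing] is the canonical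
   pairing of N with Hom(N, Q). *)
Definition pairing n (x : 'rV[int]_n) (m : 'rV[rat]_n) : rat :=
  \sum_i (x 0 i)%:~R * m 0 i.

Definition in_Mo n (D : fixed_data n) (m : 'rV[rat]_n) : Prop :=
  forall x, No D x -> pairing x m \is a Num.int.

(* v_i = {e_i, .} *)
Definition vvec n (D : fixed_data n) (e : 'I_n -> 'rV[int]_n) (i : 'I_n) :
    'rV[rat]_n :=
  \row_j form D (e i) (delta_mx 0 j).

(* [numq r] is used throughout to read a rational number known to be an integer
   as an element of int. *)
Definition mut_seed n (D : fixed_data n) (e : 'I_n -> 'rV[int]_n) (k : 'I_n) :
    'I_n -> 'rV[int]_n :=
  fun i => if i == k then - e k
           else e i + numq (Num.max 0 (form D (e i) (e k) * (dd D k)%:R)) *: e k.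

(* The vertices of the tree are the words in Iuf: the root is the empty word,
   and the edge labelled k out of w leads to [rcons w k]. *)
Definition vertex n (D : fixed_data n) (w : seq 'I_n) : bool :=
  all (fun i => i \in Iuf D) w.

Definition seed_at n (D : fixed_data n) (e : 'I_n -> 'rV[int]_n)
    (w : seq 'I_n) : 'I_n -> 'rV[int]_n :=
  foldl (mut_seed D) e w.

(* (u, a, b) with w = u ++ a, w' = u ++ b and u as long as possible, so that
   the simple path from w to w' goes back along a to u and then along b. *)
Fixpoint fork (T : eqType) (w w' : seq T) : seq T * seq T * seq T :=
  match w, w' with
  | x :: t, y :: t' =>
      if x == y then let: (u, a, b) := fork t t' in (x :: u, a, b)
      else ([::], w, w')
  | _, _ => ([::], w, w')
  end.

(* Tori.  A torus of dimension n over k is handled through its function field,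
   the field of fractions of k[X_0, .., X_(n-1)], in which the X_i are the
   characters of a basis of the character lattice. *)
Definition torus_field (k : fieldType) (n : nat) : fieldType :=
  {fraction {mpoly k[n]}}.

Definition cst (k : fieldType) n (a : k) : torus_field k n :=
  tofrac (mpolyC n a).

Definition coord (k : fieldType) n (i : 'I_n) : torus_field k n :=
  tofrac (mpolyX k U_(i)).

Definition monom (k : fieldType) n (a : 'I_n -> int) : torus_field k n :=
  \prod_i coord k i ^ a i.

(* The k-linear span of the z^m with P m; k[L] when P is membership in L. *)
Definition char_span (k : fieldType) n (L : Type) (z : L -> torus_field k n)
    (P : L -> Prop) (f : torus_field k n) : Prop :=
  exists (r : nat) (c : 'I_r -> k) (m : 'I_r -> L),
    (forall j, P (m j)) /\ f = \sum_j cst n (c j) * z (m j).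

(* Substitution of g i for X_i in a rational function; this is meaningful when
   the g i are algebraically independent over k. *)
Definition subst (k : fieldType) n (g : 'I_n -> torus_field k n)
    (f : torus_field k n) : torus_field k n :=
  mmap (@cst k n) g \n_(repr f) / mmap (@cst k n) g \d_(repr f).

(* The pullback z^m |-> z^m * (1 + z^v)^(c m), where X_i = z^(b i).  When
   c v = 0 it fixes z^v, so that replacing c by -c gives its inverse. *)
Definition twist (k : fieldType) n (L : Type) (z : L -> torus_field k n)
    (b : 'I_n -> L) (v : L) (c : L -> int) :
    torus_field k n -> torus_field k n :=
  subst (fun i => z (b i) * (1 + z v) ^ c (b i)).

(* Characters of the X-tori: the character lattice is N, with its standard
   basis. *)
Definition zX (k : fieldType) n (x : 'rV[int]_n) : torus_field k n :=
  monom k (fun i => x 0 i).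

(* Characters of the A-tori: the character lattice is Mo, with the basis dual
   to the basis (d_i e_i) of No given by the root seed e. *)
Definition Mo_basis n (D : fixed_data n) (e : 'I_n -> 'rV[int]_n) (i : 'I_n) :
    'rV[rat]_n :=
  (col i (invmx (\matrix_(j, l) ((dd D j)%:R * (e j 0 l)%:~R : rat))))^T.

Definition zA (k : fieldType) n (D : fixed_data n) (e : 'I_n -> 'rV[int]_n)
    (m : 'rV[rat]_n) : torus_field k n :=
  monom k (fun i => numq ((dd D i)%:R * pairing (e i) m)).

(* [brX D e j x] is [x, e_j] and [brA D e j m] is <d_j e_j, m>. *)
Definition brX n (D : fixed_data n) (e : 'I_n -> 'rV[int]_n) (j : 'I_n)
    (x : 'rV[int]_n) : int :=
  numq (form D x (e j) * (dd D j)%:R).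

Definition brA n (D : fixed_data n) (e : 'I_n -> 'rV[int]_n) (j : 'I_n)
    (m : 'rV[rat]_n) : int :=
  numq ((dd D j)%:R * pairing (e j) m).

(* Pullbacks of rational functions along the mutation out of the torus of the
   seed e in direction j, and along its inverse.  In the A-case e0 is the root
   seed, which fixes the coordinates. *)
Definition mutX (k : fieldType) n (D : fixed_data n) e j :=
  twist (@zX k n) (fun i => delta_mx 0 i) (e j) (fun x => - brX D e j x).

Definition mutX_inv (k : fieldType) n (D : fixed_data n) e j :=
  twist (@zX k n) (fun i => delta_mx 0 i) (e j) (brX D e j).

Definition mutA (k : fieldType) n (D : fixed_data n) e0 e j :=
  twist (@zA k n D e0) (Mo_basis D e0) (vvec D e j) (fun m => - brA D e j m).

Definition mutA_inv (k : fieldType) n (D : fixed_data n) e0 e j :=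
  twist (@zA k n D e0) (Mo_basis D e0) (vvec D e j) (brA D e j).

(* For the descending path b out of a vertex with seed e: pullback along the
   composite of the mutations in b, and along its inverse. *)
Fixpoint pull_down n (F : Type) (D : fixed_data n)
    (mu : ('I_n -> 'rV[int]_n) -> 'I_n -> F -> F)
    (e : 'I_n -> 'rV[int]_n) (b : seq 'I_n) (f : F) : F :=
  if b is j :: b' then mu e j (pull_down D mu (mut_seed D e j) b' f) else f.

Fixpoint pull_up n (F : Type) (D : fixed_data n)
    (mu_inv : ('I_n -> 'rV[int]_n) -> 'I_n -> F -> F)
    (e : 'I_n -> 'rV[int]_n) (a : seq 'I_n) (f : F) : F :=
  if a is j :: a' then pull_up D mu_inv (mut_seed D e j) a' (mu_inv e j f)
  else f.

(* The pullback mu_{w,w'}^* from the function field of the torus at w' to that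
   of the torus at w, for the tree with root seed e. *)
Definition transX (k : fieldType) n (D : fixed_data n) e (w w' : seq 'I_n)
    (f : torus_field k n) : torus_field k n :=
  let: (u, a, b) := fork w w' in
  pull_up D (@mutX_inv k n D) (seed_at D e u) a
    (pull_down D (@mutX k n D) (seed_at D e u) b f).

Definition transA (k : fieldType) n (D : fixed_data n) e (w w' : seq 'I_n)
    (f : torus_field k n) : torus_field k n :=
  let: (u, a, b) := fork w w' in
  pull_up D (@mutA_inv k n D e) (seed_at D e u) a
    (pull_down D (@mutA k n D e) (seed_at D e u) b f).

(* Laurent polynomials, i.e. regular functions on a seed torus. *)
Definition laurentX (k : fieldType) n (f : torus_field k n) : Prop :=
  char_span (@zX k n) (fun _ => True) f.

Definition laurentA (k : fieldType) n (D : fixed_data n) e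
    (f : torus_field k n) : Prop :=
  char_span (zA k D e) (in_Mo D) f.

(* Global sections of the structure sheaf of a scheme glued from the tori
   T_w (w a vertex) along birational maps: families of regular functions on the
   T_w which agree on the overlaps.  Each overlap is a nonempty open subset of
   an integral scheme, so agreement there is agreement in the function field. *)
Definition glued_section n (D : fixed_data n) (F : Type) (regular : F -> Prop)
    (trans : seq 'I_n -> seq 'I_n -> F -> F) (s : seq 'I_n -> F) : Prop :=
  (forall w, vertex D w -> regular (s w)) /\
  (forall w w', vertex D w -> vertex D w' -> trans w w' (s w') = s w).

Definition H0X (k : fieldType) n (D : fixed_data n) e :=
  glued_section D (@laurentX k n) (@transX k n D e).

Definition H0A (k : fieldType) n (D : fixed_data n) e :=
  glued_section D (@laurentA k n D e) (@transA k n D e).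

(* The rational function on the glued scheme given by f on the root torus, as
   the family of its expressions on all the seed tori. *)
Definition ratX (k : fieldType) n (D : fixed_data n) e (f : torus_field k n) :
    seq 'I_n -> torus_field k n :=
  fun w => transX D e w [::] f.

Definition ratA (k : fieldType) n (D : fixed_data n) e (f : torus_field k n) :
    seq 'I_n -> torus_field k n :=
  fun w => transA D e w [::] f.

(* The fan consisting of {0} and of the rays R_{>=0} g i for i in J. *)
Definition ray_fan (R : realType) n (J : {set 'I_n}) (g : 'I_n -> 'rV[R]_n)
    (sigma : 'rV[R]_n -> Prop) : Prop :=
  (forall u, sigma u <-> u = 0) \/
  (exists2 i, i \in J & forall u, sigma u <-> exists2 t, 0 <= t & u = t *: g i).

(* Regular functions on the toric variety of a fan: the toric variety is glued
   from the Spec k[sigma^vee \cap L], sigma in the fan, along opens containing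
   the torus.  Here L is the character lattice and ev its evaluation on the real
   vector space containing the fan. *)
Definition TV_regular (R : realType) (k : fieldType) n (T : Type)
    (z : T -> torus_field k n) (L : T -> Prop) (ev : T -> 'rV[R]_n -> R)
    (fan : ('rV[R]_n -> Prop) -> Prop) (f : torus_field k n) : Prop :=
  forall sigma, fan sigma ->
    char_span z (fun m => L m /\ forall u, sigma u -> 0 <= ev m u) f.

Definition TV_A_regular (R : realType) (k : fieldType) n (D : fixed_data n) e
    (f : torus_field k n) : Prop :=
  TV_regular (zA k D e) (in_Mo D)
    (fun m (u : 'rV[R]_n) => \sum_i ratr (m 0 i) * u 0 i)
    (ray_fan (Iuf D) (fun i => map_mx intr ((dd D i)%:Z *: e i))) f.

Definition TV_X_regular (R : realType) (k : fieldType) n (D : fixed_data n) e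
    (f : torus_field k n) : Prop :=
  TV_regular (@zX k n) (fun _ => True)
    (fun x (u : 'rV[R]_n) => \sum_i (x 0 i)%:~R * u 0 i)
    (ray_fan (Iuf D) (fun i => - map_mx ratr ((dd D i)%:R *: vvec D e i))) f.

(* Main.v *)
Require Import Defs.
From HB Require Import structures.
From mathcomp Require Import all_boot all_order all_algebra.
From mathcomp Require Import mpoly.
From mathcomp Require Import reals.
From mathcomp Require Import ring zify.
Set Implicit Arguments.
Unset Strict Implicit.
Unset Printing Implicit Defensive.
Import Order.TTheory GRing.Theory Num.Theory.
Local Open Scope ring_scope.

(** Both halves of the theorem are instances of one statement.  To pass
    to an adjacent seed, functions are rewritten by the pullback along the
    inverse of a mutation, that is, by the automorphism
    z^m |-> z^m (1 + z^p)^<c,m> of the function field of a torus, with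
    <c,p> = 0; it is called a mutation below.  For a seed (e_i) the pair (p, c) attached to k is
    (v_k, d_k e_k) for A and (e_k, [-, e_k]) for X.  In both cases p is a linear
    function phi of e_k and c a linear function psi of d_k e_k, and
    <c_j, p_i> = {e_i, e_j} d_j.

    Say that f lies in the upper bound of a seed when f is a Laurent polynomial
    on the torus of that seed and on the tori of all adjacent seeds.  If
    <c_i, q> >= 0 for all i, then z^q lies in the upper bound of the root, its
    expressions next to the root being z^q (1 + z^(p_i))^<c_i,q>.  The theorem
    follows once the upper bound is shown to be invariant under mutation
    ([upper_bound_mut]), by induction along the path.

    Invariance involves two directions at a time ([laurent_two_steps]).  Let
    s and t be the mutations for (p1, c1) and (p2, c2), put A = 1 + z^p1,
    B = 1 + z^p2, a = <c2, p1>, and let f, s f and t f be Laurent polynomials,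
    with a >= 0.  Splitting f by c2-degree shows that f is a sum of terms y B^r
    with y of degree j >= - r.  Up to powers of A2 = t A = 1 + z^p1 B^a, the
    function t (s y) is a multiple of B^j, and t (s B) is a multiple of B,
    because A2 = 1 modulo B when a > 0.  Hence t (s f) has only powers of A2 as
    denominators.  Being t applied to the Laurent polynomial s f, it also has
    only powers of B as denominators; as A2 and B are coprime, it is a Laurent
    polynomial.  If a < 0, then s is rewritten as a mutation in z^(-p1) followed
    by a monomial change of coordinates ([scale_shear]), which changes the sign
    of a ([laurent_two_steps_neg]).

    If a = 0, then A2 = A, and 1 + z^p1 and 1 + z^p2 are not coprime when p1 and
    p2 are proportional; then the upper bound is not invariant in general.  So
    the induction is carried out with principal coefficients: p_i is replaced by
    (p_i, e_i) in a larger lattice, where these vectors are part of a basis for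
    every seed, and the additional characters are set equal to 1 at the end.
    This specialisation commutes with mutations of Laurent polynomials
    ([forget_scale]).

    Substitutions between function fields (mutations, this specialisation, the
    evaluation z^p1 = - 1 behind coprimality) are all treated by the relation
    [specializes]: a fraction takes a value when it can be written with a
    denominator that does not vanish.  Evaluating the inverse substitution shows
    that mutations are automorphisms.

    Finally, z^q is a combination of characters in a half space only if q lies
    in that half space ([zX_span_deg_ge0]), which gives the comparison with the
    toric varieties; and the expressions of z^q on the tori agree under all the
    transition maps since these go back and forth along paths in a tree
    ([glued_section_root]). *)

(** * Values of fractions under a partially defined substitution *)

Section PartialExtension.
Variables (A : comNzRingType) (K K' : fieldType).
Variables (i : {rmorphism A -> K}) (f : {rmorphism A -> K'}).
Hypothesis i_inj : injective i.

(** The graph of the extension of f to the fractions i P / i Q with f Q nonzero.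
    A relation is used because the existence of such a representation of x
    depends on x. *)
Definition specializes (x : K) (y : K') : Prop :=
  exists P Q : A, [/\ f Q != 0, x = i P / i Q & y = f P / f Q].

Lemma denominator_neq0 Q : f Q != 0 -> i Q != 0.
Proof.
apply: contra => /eqP E; have -> : Q = 0 by apply: i_inj; rewrite E rmorph0.
by rewrite rmorph0.
Qed.

Lemma specializes_image P : specializes (i P) (f P).
Proof. by exists P, 1; rewrite !rmorph1 oner_neq0 !divr1. Qed.

Lemma specializes_fun x y y' : specializes x y -> specializes x y' -> y = y'.
Proof.
move=> [P [Q [Q0 -> ->]]] [P' [Q' [Q0' E ->]]].
apply/eqP; rewrite eqr_div // -!rmorphM; apply/eqP; congr (f _); apply: i_inj.
by apply/eqP; rewrite !rmorphM -eqr_div ?denominator_neq0 // E.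
Qed.

Lemma specializesD x y x' y' :
  specializes x y -> specializes x' y' -> specializes (x + x') (y + y').
Proof.
move=> [P [Q [Q0 -> ->]]] [P' [Q' [Q0' -> ->]]].
exists (P * Q' + P' * Q), (Q * Q'); split.
- by rewrite rmorphM mulf_neq0.
- by rewrite addf_div ?denominator_neq0 // rmorphD !rmorphM.
- by rewrite addf_div // rmorphD !rmorphM.
Qed.

Lemma specializesM x y x' y' :
  specializes x y -> specializes x' y' -> specializes (x * x') (y * y').
Proof.
move=> [P [Q [Q0 -> ->]]] [P' [Q' [Q0' -> ->]]].
exists (P * P'), (Q * Q'); split.
- by rewrite rmorphM mulf_neq0.
- by rewrite mulf_div !rmorphM.
- by rewrite mulf_div !rmorphM.
Qed.

Lemma specializes0 : specializes 0 0.
Proof. by have := specializes_image 0; rewrite !rmorph0. Qed.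

Lemma specializes1 : specializes 1 1.
Proof. by have := specializes_image 1; rewrite !rmorph1. Qed.

Lemma specializesN x y : specializes x y -> specializes (- x) (- y).
Proof.
move=> [P [Q [Q0 -> ->]]]; exists (- P), Q.
by rewrite !rmorphN !mulNr.
Qed.

Lemma specializesV x y : y != 0 -> specializes x y -> specializes x^-1 y^-1.
Proof.
move=> y0 [P [Q [Q0 -> Ey]]]; exists Q, P; split.
- by apply: contra y0 => /eqP E; rewrite Ey E mul0r.
- by rewrite invf_div.
- by rewrite Ey invf_div.
Qed.

(** The device by which elements of a function field are proved to be nonzero:
    evaluate them at a well-chosen point. *)
Lemma specializes_neq0 x y : y != 0 -> specializes x y -> x != 0.
Proof.
move=> y0 S; apply: contra y0 => /eqP E; rewrite E in S.
by rewrite (specializes_fun S specializes0).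
Qed.

Lemma specializesX x y m : specializes x y -> specializes (x ^+ m) (y ^+ m).
Proof.
move=> S; elim: m => [|m IH]; first by rewrite !expr0; exact: specializes1.
by rewrite !exprS; exact: specializesM.
Qed.

Lemma specializesXz x y (m : int) :
  y != 0 -> specializes x y -> specializes (x ^ m) (y ^ m).
Proof.
move=> y0 S; case: m => m; first exact: specializesX.
rewrite !NegzE -!exprnN; apply: specializesV; first by rewrite expf_neq0.
exact: specializesX.
Qed.

Lemma specializes_prod (I : finType) (u : I -> K) v :
  (forall i, specializes (u i) (v i)) ->
  specializes (\prod_i u i) (\prod_i v i).
Proof.
by move=> H; apply: big_ind2 => //; [exact: specializes1 | exact: specializesM].
Qed.

Lemma specializes_quotient P Q :
  f Q != 0 -> specializes (i P / i Q) (f P / f Q).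
Proof. by move=> Q0; exists P, Q. Qed.

End PartialExtension.

(** * Function fields of tori and their substitutions *)

Section Substitution.
Variable k : fieldType.

Lemma cst_is_zmod n : zmod_morphism (@cst k n).
Proof. by move=> x y; rewrite /cst mpolyCB rmorphB. Qed.
HB.instance Definition _ n :=
  GRing.isZmodMorphism.Build k (torus_field k n) (@cst k n) (@cst_is_zmod n).
Lemma cst_is_monoid n : monoid_morphism (@cst k n).
Proof. by split=> [|x y]; rewrite /cst ?mpolyC1 ?rmorph1 // mpolyCM rmorphM. Qed.
HB.instance Definition _ n :=
  GRing.isMonoidMorphism.Build k (torus_field k n) (@cst k n) (@cst_is_monoid n).

(** The two ring morphisms out of the polynomial ring to which [specializes] is
    applied: the inclusion in the function field, and a substitution. *)
Definition tofracT n : {rmorphism {mpoly k[n]} -> torus_field k n} :=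
  @tofrac {mpoly k[n]}.

Definition evaluation n n' (g : 'I_n -> torus_field k n') :
  {rmorphism {mpoly k[n]} -> torus_field k n'} := mmap (@cst k n') g.

Lemma tofracT_inj n : injective (tofracT n).
Proof. by move=> P Q /eqP; rewrite tofrac_eq => /eqP. Qed.

Lemma frac_numden n (f : torus_field k n) :
  f = tofracT n \n_(repr f) / tofracT n \d_(repr f).
Proof.
have d0 : \d_(repr f) != 0 by exact: denom_ratioP.
rewrite -[LHS]reprK /tofracT /=; unlock FracField.tofrac.
rewrite -[X in _ = _ * X]FracField.pi_inv -[RHS]FracField.pi_mul.
rewrite /FracField.mulf /FracField.invf /=.
by rewrite !numden_Ratio ?oner_neq0 // ?mul1r ?mulr1 Ratio_numden.
Qed.

Lemma substE n (g : 'I_n -> torus_field k n) f :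
  subst g f = evaluation g \n_(repr f) / evaluation g \d_(repr f).
Proof. by []. Qed.

Lemma coordE n (i : 'I_n) : Defs.coord k i = tofracT n 'X_i.
Proof. by []. Qed.

Lemma evaluation_coord n n' (g : 'I_n -> torus_field k n') i :
  evaluation g 'X_i = g i.
Proof. by rewrite /evaluation /= mmapX mmap1U. Qed.

Lemma evaluation_cst n n' (g : 'I_n -> torus_field k n') a :
  evaluation g (mpolyC n a) = cst n' a.
Proof. by rewrite /evaluation /= mmapC. Qed.

Lemma denominatorT_neq0 n (f : torus_field k n) : \d_(repr f) != 0.
Proof. exact: denom_ratioP. Qed.

Lemma subst_eq n (g g' : 'I_n -> torus_field k n) f :
  g =1 g' -> subst g f = subst g' f.
Proof.
move=> E; rewrite /subst /mmap.
by congr (_ / _); apply: eq_bigr => m _; congr (_ * _); apply: mmap1_eq.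
Qed.

Lemma mpoly_ind n (W : {mpoly k[n]} -> Prop) :
  (forall a, W (mpolyC n a)) -> (forall i, W 'X_i) ->
  (forall P Q, W P -> W Q -> W (P + Q)) ->
  (forall P Q, W P -> W Q -> W (P * Q)) -> forall P, W P.
Proof.
move=> WC WX WD WM P; rewrite [P]mpolyE; apply: big_ind => //.
  by rewrite -mpolyC0.
move=> m _; rewrite -mul_mpolyC; apply: (WM) => //.
rewrite mpolyXE_id; apply: big_ind => //; first by rewrite -mpolyC1.
move=> i _; elim: (m i) => [|r IH]; first by rewrite expr0 -mpolyC1.
by rewrite exprS; apply: WM.
Qed.

End Substitution.

Section Characters.
Variable k : fieldType.
Local Notation X := (@zX k _).
Implicit Type n : nat.

Lemma coord_neq0 n (i : 'I_n) : Defs.coord k i != 0.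
Proof.
rewrite coordE -(rmorph0 (tofracT k n)) (inj_eq (@tofracT_inj k n)).
apply/eqP => /(congr1 (mcoeff U_(i))); rewrite mcoeffX eqxx mcoeff0.
by move/eqP; rewrite oner_eq0.
Qed.

Lemma zX_neq0 n (x : 'rV[int]_n) : X x != 0.
Proof. by apply/prodf_neq0 => i _; rewrite expfz_neq0 ?coord_neq0. Qed.

Lemma zXE n (x : 'rV[int]_n) : X x = \prod_i Defs.coord k i ^ x 0 i.
Proof. by []. Qed.

Lemma zXD n (x y : 'rV[int]_n) : X (x + y) = X x * X y.
Proof.
rewrite /zX /monom -big_split /=; apply: eq_bigr => i _.
by rewrite mxE expfzDr ?coord_neq0.
Qed.

Lemma zX0 n : X (0 : 'rV[int]_n) = 1.
Proof. by rewrite /zX /monom big1 // => i _; rewrite mxE expr0z. Qed.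

Lemma zXN n (x : 'rV[int]_n) : X (- x) = (X x)^-1.
Proof.
by apply: (mulfI (zX_neq0 x)); rewrite -zXD subrr zX0 divff ?zX_neq0.
Qed.

Lemma zX_Mz n (x : 'rV[int]_n) (a : int) : X (a *: x) = X x ^ a.
Proof.
rewrite /zX /monom; elim/big_rec2: _ => [|i y1 y2 _ ->].
  by rewrite exp1rz.
by rewrite expfzMl mxE [a * _]mulrC exprz_exp.
Qed.

Lemma zX_delta n (i : 'I_n) : X (delta_mx 0 i) = Defs.coord k i.
Proof.
rewrite /zX /monom (bigD1 i) //= mxE !eqxx expr1z big1 ?mulr1 // => j ji.
by rewrite mxE eqxx (negbTE ji) expr0z.
Qed.

Local Notation spz g := (specializes (@tofracT k _) (evaluation g)).

Lemma specializes_coord n n' (g : 'I_n -> torus_field k n') i :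
  spz g (Defs.coord k i) (g i).
Proof. by rewrite coordE -(evaluation_coord g i); exact: specializes_image. Qed.

Lemma specializes_cst n n' (g : 'I_n -> torus_field k n') a :
  spz g (cst n a) (cst n' a).
Proof. by rewrite -(evaluation_cst g); exact: specializes_image. Qed.

Lemma specializes_zX n n' (g : 'I_n -> torus_field k n') (x : 'rV[int]_n) :
  (forall i, g i != 0) -> spz g (X x) (\prod_i g i ^ x 0 i).
Proof.
move=> g0; apply: specializes_prod => i.
by apply: specializesXz => //; exact: specializes_coord.
Qed.

(** A substitution g that is undone by some substitution g' sends no nonzero
    polynomial to 0: g' would then send 0 to that polynomial.  So every fraction
    has a value under g, and [subst] computes it. *)
Lemma subst_specializes n (g g' : 'I_n -> torus_field k n) :
  (forall i, spz g' (g i) (Defs.coord k i)) ->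
  forall x, spz g x (subst g x).
Proof.
move=> H x; rewrite substE {1}(frac_numden x); apply: specializes_quotient.
have S P : spz g' (evaluation g P) (tofracT k n P).
  move: P; apply: mpoly_ind => [a|i|P Q|P Q].
  - by rewrite evaluation_cst; exact: specializes_cst.
  - by rewrite evaluation_coord.
  - by rewrite !rmorphD; exact: specializesD (@tofracT_inj k n) _ _ _ _.
  - by rewrite !rmorphM; exact: specializesM.
apply: contra (denominatorT_neq0 x) => /eqP E.
have := S \d_(repr x); rewrite E => S0.
have := specializes_fun (@tofracT_inj k n) S0 (specializes0 _ _).
by move/eqP; rewrite -(rmorph0 (tofracT k n)) (inj_eq (@tofracT_inj k n)).
Qed.

Lemma rmorphism_ext n n' (s s' : {rmorphism torus_field k n -> torus_field k n'}) :
  (forall a, s (cst n a) = s' (cst n a)) ->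
  (forall i, s (Defs.coord k i) = s' (Defs.coord k i)) -> s =1 s'.
Proof.
move=> HC HX x; have S P : s (tofracT k n P) = s' (tofracT k n P).
  move: P; apply: mpoly_ind => [||P Q EP EQ|P Q EP EQ].
  - exact: HC.
  - exact: HX.
  - by rewrite !rmorphD EP EQ.
  - by rewrite !rmorphM EP EQ.
by rewrite (frac_numden x) !fmorph_div !S.
Qed.

End Characters.
(* From here on the function field is abstract, known by the lemmas above. *)
Opaque torus_field.

(** * Laurent polynomials, degrees, and mutations as automorphisms *)

Section Span.
Variables (k : fieldType) (n : nat) (L : Type) (z : L -> torus_field k n).
Implicit Type P : L -> Prop.

Lemma char_span_char P a m : P m -> char_span z P (cst n a * z m).
Proof.
by move=> Pm; exists 1%N, (fun=> a), (fun=> m); split => //; rewrite big_ord1.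
Qed.

Lemma char_span0 P : char_span z P 0.
Proof.
have m : 'I_0 -> L by case.
by exists 0%N, (fun=> 0), m; split; [case | rewrite big_ord0].
Qed.

Lemma char_spanD P f g : char_span z P f -> char_span z P g ->
  char_span z P (f + g).
Proof.
move=> [r [c [m [Pm ->]]]] [r' [c' [m' [Pm' ->]]]].
pose pick T (a : 'I_r -> T) (a' : 'I_r' -> T) i :=
  match split i with inl j => a j | inr j => a' j end.
exists (r + r')%N, (pick _ c c'), (pick _ m m'); split.
  by move=> i; rewrite /pick; case: (split i).
rewrite big_split_ord /=; congr (_ + _); apply: eq_bigr => i _.
  by rewrite /pick (unsplitK (inl i)).
by rewrite /pick (unsplitK (inr i)).
Qed.

Lemma char_span_ind P (W : torus_field k n -> Prop) :
  W 0 -> (forall f g, W f -> W g -> W (f + g)) ->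
  (forall a m, P m -> W (cst n a * z m)) ->
  forall f, char_span z P f -> W f.
Proof.
move=> W0 WD Wz f [r [c [m [Pm ->]]]].
by apply: big_ind => // i _; apply: Wz.
Qed.

Lemma char_spanZ P a f : char_span z P f -> char_span z P (cst n a * f).
Proof.
move: f; apply: char_span_ind.
- by rewrite mulr0; exact: char_span0.
- by move=> f g; rewrite mulrDr; exact: char_spanD.
- by move=> b m Pm; rewrite mulrA -rmorphM; exact: char_span_char.
Qed.

Lemma char_span_sum P (I : Type) (s : seq I) (Q : pred I)
    (f : I -> torus_field k n) :
  (forall i, Q i -> char_span z P (f i)) ->
  char_span z P (\sum_(i <- s | Q i) f i).
Proof.
by move=> H; apply: big_ind => //; [exact: char_span0 | exact: char_spanD].
Qed.

End Span.

Section Laurent.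
Variables (k : fieldType) (n : nat).
Local Notation F := (torus_field k n).
Local Notation X := (@zX k n).
Local Notation laurent := (@laurentX k n).
Implicit Types (f g : F) (m p : 'rV[int]_n) (c : 'cV[int]_n).

Lemma char_span_zXM (P1 P2 P3 : 'rV[int]_n -> Prop) f g :
  (forall m m', P1 m -> P2 m' -> P3 (m + m')) ->
  char_span X P1 f -> char_span X P2 g -> char_span X P3 (f * g).
Proof.
move=> HP Pf Pg; move: f Pf; apply: char_span_ind => [|f f'|a m Pm].
- by rewrite mul0r; exact: char_span0.
- by rewrite mulrDl; exact: char_spanD.
- move: g Pg; apply: char_span_ind => [|g g'|b m' Pm'].
  + by rewrite mulr0; exact: char_span0.
  + by rewrite mulrDr; exact: char_spanD.
  + rewrite mulrACA -rmorphM -zXD.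
    by apply: char_span_char; apply: HP.
Qed.

Lemma laurentD f g : laurent f -> laurent g -> laurent (f + g).
Proof. exact: char_spanD. Qed.

Lemma laurentM f g : laurent f -> laurent g -> laurent (f * g).
Proof. exact: char_span_zXM. Qed.

Lemma laurent_zX m : laurent (X m).
Proof. by rewrite -[X m]mul1r -(rmorph1 (@cst k n)); exact: char_span_char. Qed.

Lemma laurent_cst a : laurent (cst n a).
Proof. by rewrite -[cst n a]mulr1 -(zX0 k n); exact: char_span_char. Qed.

Lemma laurent0 : laurent 0. Proof. exact: char_span0. Qed.

Lemma laurent1 : laurent 1.
Proof. by rewrite -(rmorph1 (@cst k n)); exact: laurent_cst. Qed.

Lemma laurentN f : laurent f -> laurent (- f).
Proof. by rewrite -mulN1r -(rmorphN1 (@cst k n)); exact: char_spanZ. Qed.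

Lemma laurentB f g : laurent f -> laurent g -> laurent (f - g).
Proof. by move=> Lf Lg; apply: laurentD => //; exact: laurentN. Qed.

Lemma laurent_exp f r : laurent f -> laurent (f ^+ r).
Proof.
move=> Lf; elim: r => [|r IH]; first by rewrite expr0; exact: laurent1.
by rewrite exprS; exact: laurentM.
Qed.

Definition deg c m : int := (m *m c) 0 0.

Lemma degD c m m' : deg c (m + m') = deg c m + deg c m'.
Proof. by rewrite /deg mulmxDl mxE. Qed.

Lemma degN c m : deg c (- m) = - deg c m.
Proof. by rewrite /deg mulNmx mxE. Qed.

Lemma degZ c a m : deg c (a *: m) = a * deg c m.
Proof. by rewrite /deg -scalemxAl mxE. Qed.

Lemma deg0 c : deg c 0 = 0.
Proof. by rewrite /deg mul0mx mxE. Qed.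

Lemma deg_covecN c m : deg (- c) m = - deg c m.
Proof. by rewrite /deg mulmxN mxE. Qed.

Lemma deg_covecD c c' m : deg (c + c') m = deg c m + deg c' m.
Proof. by rewrite /deg mulmxDr mxE. Qed.

Lemma deg_covecZ a c m : deg (a *: c) m = a * deg c m.
Proof. by rewrite /deg -scalemxAr mxE. Qed.

Lemma deg_delta c i : deg c (delta_mx 0 i) = c i 0.
Proof. by rewrite /deg -rowE mxE. Qed.

Lemma deg_mulmx c m : deg c m = (m *m c) 0 0.
Proof. by []. Qed.

Lemma degE c m : deg c m = \sum_i m 0 i * c i 0.
Proof. by rewrite /deg mxE. Qed.

Definition of_degree c (j : int) : F -> Prop := char_span X (fun m => deg c m = j).

Lemma of_degreeM c i j f g : of_degree c i f -> of_degree c j g -> of_degree c (i + j) (f * g).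
Proof. by apply: char_span_zXM => m m' <- <-; rewrite degD. Qed.

Lemma of_degree_zX c m : of_degree c (deg c m) (X m).
Proof. by rewrite -[X m]mul1r -(rmorph1 (@cst k n)); exact: char_span_char. Qed.

Lemma of_degree_cst c a : of_degree c 0 (cst n a).
Proof.
by rewrite -[cst n a]mulr1 -(zX0 k n); apply: char_span_char; rewrite deg0.
Qed.

Lemma of_degreeN c j f : of_degree c j f -> of_degree (- c) (- j) f.
Proof.
case=> r [a [m [H ->]]]; exists r, a, m; split=> // i.
by rewrite deg_covecN H.
Qed.

(** The common form z^m |-> z^m u^<c,m> of all the automorphisms below: a
    mutation for u = 1 + z^p, a monomial change of coordinates for u = z^p, the
    action of a one-parameter subgroup for a constant u. *)
Definition scale (u : F) c : F -> F :=
  subst (fun i => Defs.coord k i * u ^ c i 0).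

Section ScaleMorphism.
Variables (u : F) (c : 'cV[int]_n).
Hypotheses (u0 : u != 0) (uc : of_degree c 0 u).

Local Notation spz u c :=
  (specializes (tofracT k n) (evaluation (fun i => Defs.coord k i * u ^ c i 0))).

Lemma specializes_scale_zX (v : F) c' m :
  v != 0 -> spz v c' (X m) (X m * v ^ deg c' m).
Proof.
move=> v0; suff -> : X m * v ^ deg c' m
    = \prod_i (Defs.coord k i * v ^ c' i 0) ^ m 0 i.
  by apply: specializes_zX => i; rewrite mulf_neq0 ?coord_neq0 ?expfz_neq0.
rewrite degE /zX /monom; under [RHS]eq_bigr do rewrite expfzMl.
rewrite big_split /=; congr (_ * _).
elim/big_rec2: _ => [|i y1 y2 _ <-]; first by rewrite expr0z.
by rewrite expfzDr // exprz_exp [m 0 i * _]mulrC.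
Qed.

Lemma specializes_scale_of_degree (v : F) c' j f :
  v != 0 -> of_degree c' j f -> spz v c' f (f * v ^ j).
Proof.
move=> v0; move: f; apply: char_span_ind => [|f g Sf Sg|a m Hm].
- by rewrite mul0r; exact: specializes0.
- by rewrite mulrDl; exact: specializesD (@tofracT_inj k n) _ _ _ _ Sf Sg.
- rewrite -mulrA -Hm; apply: specializesM; first exact: specializes_cst.
  exact: specializes_scale_zX.
Qed.

(** As u has degree 0 it is fixed by the substitution built from u and - c, which
    therefore undoes the one built from u and c. *)
Lemma scale_specializes f : spz u c f (scale u c f).
Proof.
apply: (@subst_specializes k n _ (fun i => Defs.coord k i * u ^ (- c) i 0)) => i.
have S := specializes_scale_of_degree u0 (of_degreeN uc).
rewrite oppr0 expr0z mulr1 in S.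
have := specializesM (specializes_scale_zX (- c) (delta_mx 0 i) u0)
  (specializesXz (c i 0) u0 S).
by rewrite zX_delta deg_delta -mulrA -expfzDr // [(- c) i 0]mxE addNr expr0z mulr1.
Qed.

Lemma scale_rmorphism : exists s : {rmorphism F -> F},
  [/\ scale u c =1 s, forall a, s (cst n a) = cst n a &
      forall j f, of_degree c j f -> s f = f * u ^ j].
Proof.
have F_fun f g : spz u c f g -> scale u c f = g.
  by apply: (specializes_fun (@tofracT_inj k n)); exact: scale_specializes.
have sD : zmod_morphism (scale u c).
  move=> f g; apply: F_fun; apply: (specializesD (@tofracT_inj k n)).
    exact: scale_specializes.
  by apply: specializesN; exact: scale_specializes.
have sM : monoid_morphism (scale u c).
  split; first by apply: F_fun; exact: specializes1.
  by move=> f g; apply: F_fun; apply: specializesM; exact: scale_specializes.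
pose s : {rmorphism F -> F} := HB.pack (scale u c)
  (GRing.isZmodMorphism.Build _ _ _ sD) (GRing.isMonoidMorphism.Build _ _ _ sM).
exists s; split=> // [a|j f Hf]; apply: F_fun; first exact: specializes_cst.
exact: specializes_scale_of_degree.
Qed.

End ScaleMorphism.

Lemma scaleK (u : F) c : u != 0 -> of_degree c 0 u ->
  cancel (scale u c) (scale u (- c)).
Proof.
move=> u0 uc f; have uc' := of_degreeN uc; rewrite oppr0 in uc'.
have [s [Es sC sH]] := scale_rmorphism u0 uc.
have [s' [Es' sC' sH']] := scale_rmorphism u0 uc'.
rewrite Es Es'; apply: (@rmorphism_ext k n n (s' \o s) idfun) => [a|i] /=.
  by rewrite sC sC'.
rewrite -zX_delta (sH _ _ (of_degree_zX c _)) (rmorphM s').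
rewrite (sH' _ _ (of_degree_zX (- c) _)) fmorphXz (sH' _ _ uc').
by rewrite expr0z mulr1 -mulrA -expfzDr // deg_covecN addNr expr0z mulr1.
Qed.

End Laurent.
Opaque deg zX scale.

(** * The grading of Laurent polynomials by a covector *)

Section Grading.
Variables (k : fieldType) (hk : [pchar k] =i pred0) (n : nat).
Local Notation F := (torus_field k n).
Local Notation X := (@zX k n).
Local Notation laurent := (@laurentX k n).
Implicit Types (f g u : F) (m p : 'rV[int]_n) (c : 'cV[int]_n).

Lemma natr_neq0 r : (0 < r)%N -> (r%:R : k) != 0.
Proof. by rewrite (pcharf0P k).1 // -lt0n. Qed.

(** In characteristic 0, the element 2 of the one-parameter subgroup of c acts on
    the homogeneous parts of different degrees by different scalars. *)
Lemma expr2z_inj : injective (fun j : int => (2%:R : k) ^ j).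
Proof.
have two0 := natr_neq0 (isT : (0 < 2)%N).
have H (r : nat) : (2%:R : k) ^+ r = 1 -> r = 0%N.
  move=> E; have : ((2 ^ r - 1)%:R : k) == 0.
    by rewrite natrB ?expn_gt0 // natrX E subrr.
  rewrite (pcharf0P k).1 // subn_eq0 -{2}(expn0 2) leq_exp2l //.
  by rewrite leqn0 => /eqP.
move=> i j /= E; apply/eqP; rewrite -subr_eq0.
have {E} : (2%:R : k) ^ (i - j) = 1.
  by rewrite expfzDr // E -expfzDr // subrr expr0z.
case: (i - j) => r; first by move/H => ->.
rewrite NegzE -exprnN => /eqP; rewrite invr_eq1 => /eqP /H; lia.
Qed.

Lemma cst_neq0 a : a != 0 -> cst n a != 0 :> F.
Proof. by rewrite fmorph_eq0. Qed.

Lemma cst_exprz a (j : int) : cst n a ^ j = cst n (a ^ j) :> F.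
Proof. by case: j => r; rewrite ?NegzE -?exprnN ?fmorphV !rmorphXn. Qed.

Lemma scaleX u c : u != 0 -> of_degree c 0 u ->
  forall m, scale u c (X m) = X m * u ^ deg c m.
Proof.
move=> u0 uc m; have [s [Es _ sH]] := scale_rmorphism u0 uc.
by rewrite Es (sH _ _ (of_degree_zX k c m)).
Qed.

Lemma scaleC u v c c' f : u != 0 -> v != 0 ->
  of_degree c 0 u -> of_degree c' 0 u -> of_degree c 0 v -> of_degree c' 0 v ->
  scale u c (scale v c' f) = scale v c' (scale u c f).
Proof.
move=> u0 v0 uc uc' vc vc'.
have [s [Es sC sH]] := scale_rmorphism u0 uc.
have [t [Et tC tH]] := scale_rmorphism v0 vc'.
rewrite !Es !Et; apply: (@rmorphism_ext k n n (s \o t) (t \o s)) => [a|i] /=.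
  by rewrite sC tC sC.
rewrite -zX_delta (sH _ _ (of_degree_zX k c _)) (tH _ _ (of_degree_zX k c' _)).
rewrite (rmorphM s) (rmorphM t) !fmorphXz (sH _ _ vc) (tH _ _ uc').
rewrite (sH _ _ (of_degree_zX k c _)) (tH _ _ (of_degree_zX k c' _)).
rewrite (expr0z u) (expr0z v) (mulr1 u) (mulr1 v); exact: mulrAC.
Qed.

Lemma laurent_scale u c f : u != 0 -> of_degree c 0 u ->
  (forall j : int, laurent (u ^ j)) -> laurent f -> laurent (scale u c f).
Proof.
move=> u0 uc Lu; have [s [Es sC sH]] := scale_rmorphism u0 uc; rewrite Es.
move: f; apply: char_span_ind => [|f g|a m _].
- by rewrite rmorph0; exact: laurent0.
- by rewrite rmorphD; exact: laurentD.
- rewrite rmorphM sC (sH _ _ (of_degree_zX k c m)).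
  apply: laurentM; first exact: laurent_cst.
  by apply: laurentM; first exact: laurent_zX.
Qed.

Local Notation two := (cst n 2%:R : F).

Lemma two_neq0 : two != 0.
Proof. by apply: cst_neq0; apply: natr_neq0. Qed.

Lemma laurent_two (j : int) : laurent (two ^ j).
Proof. by rewrite cst_exprz; exact: laurent_cst. Qed.

(** Homogeneous elements are eigenvectors of z^m |-> 2^<c,m> z^m with different
    eigenvalues, so a subspace stable under that map contains the components of
    each of its elements.  For W = 0 this is the independence of homogeneous
    elements of different degrees. *)
Lemma graded_components c (W : F -> Prop) :
  (forall f g, W f -> W g -> W (f - g)) ->
  (forall a f, W f -> W (cst n a * f)) ->
  (forall f, W f -> W (scale two c f)) ->
  forall (js : seq int) (u : int -> F), uniq js ->
    (forall j, of_degree c j (u j)) -> W (\sum_(j <- js) u j) ->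
    forall j, j \in js -> W (u j).
Proof.
move=> WB WZ Wth; have [s [Es sC sH]] := scale_rmorphism two_neq0 (of_degree_cst c _).
elim=> [|i js IH] u //= /andP[ijs ujs] uh; rewrite big_cons => Wu.
have Wjs j : j \in js -> W (u j).
  move=> jjs; have ji : 2%:R ^ j - 2%:R ^ i != 0 :> k.
    rewrite subr_eq0; apply: contra ijs => /eqP /expr2z_inj <-; exact: jjs.
  have {IH} := IH (fun j => cst n (2%:R ^ j - 2%:R ^ i) * u j) ujs.
  move=> /(_ _ _ _ jjs) H; rewrite -[u j]mul1r -(rmorph1 (@cst k n)).
  rewrite -(mulVf ji) rmorphM -mulrA; apply: (WZ); apply: H.
    by move=> j'; exact: char_spanZ (uh j').
  (* subtracting 2^i times the sum from its image removes the i-th term *)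
  have := WB _ _ (Wth _ Wu) (WZ (2%:R ^ i) _ Wu).
  rewrite Es rmorphD (sH _ _ (uh i)) rmorph_sum mulrDr cst_exprz.
  rewrite opprD addrACA [cst n _ * u i]mulrC subrr add0r mulr_sumr -sumrB.
  congr W.
  apply: eq_bigr => j' _; rewrite (sH _ _ (uh j')) cst_exprz.
  by rewrite rmorphB mulrBl [u j' * _]mulrC.
move=> j; rewrite inE => /orP[/eqP -> | /Wjs //].
have W0 : W 0 by rewrite -(subrr (u i + \sum_(j <- js) u j)); exact: WB.
have WN f : W f -> W (- f) by rewrite -sub0r; exact: WB.
rewrite -[u i](addrK (\sum_(j <- js) u j)); apply: (WB) => //.
rewrite big_seq; apply: big_ind => // f g Wf Wg.
by rewrite -[g]opprK; apply: (WB) => //; exact: WN.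
Qed.

Lemma graded_decomposition c (P : 'rV[int]_n -> Prop) f : char_span X P f ->
  exists (js : seq int) (u : int -> F),
  [/\ uniq js, forall j, of_degree c j (u j), f = \sum_(j <- js) u j &
      forall j, j \in js -> exists2 m, P m & deg c m = j].
Proof.
move=> [r [a [m [Pm ->]]]].
exists (undup [seq deg c (m i) | i : 'I_r]),
  (fun j => \sum_(i | deg c (m i) == j) cst n (a i) * X (m i)); split.
- exact: undup_uniq.
- by move=> j; apply: char_span_sum => i /eqP <-; exact: char_span_char.
- rewrite (exchange_big_dep predT) //=; apply: eq_bigr => i _.
  rewrite -big_filter (_ : filter _ _ = [:: deg c (m i)]) ?big_seq1 //.
  rewrite (eq_filter (a2 := pred1 (deg c (m i)))).
    apply: filter_pred1_uniq; first exact: undup_uniq.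
    by rewrite mem_undup; apply: image_f.
  by move=> j /=; rewrite eq_sym.
- by move=> j; rewrite mem_undup => /mapP[i _ ->]; exists (m i).
Qed.

Lemma of_degreeP c j f : laurent f -> scale two c f = two ^ j * f ->
  of_degree c j f.
Proof.
move=> Lf; have [js [u [ujs uh -> _]]] := graded_decomposition c Lf => E.
have [s [Es sC sH]] := scale_rmorphism two_neq0 (of_degree_cst c _).
have Z : forall i, i \in js -> cst n (2%:R ^ i - 2%:R ^ j) * u i = 0.
  apply: (@graded_components c (fun f => f = 0)) => //.
  - by move=> g h -> ->; rewrite subr0.
  - by move=> b g ->; rewrite mulr0.
  - by move=> g ->; rewrite Es rmorph0.
  - by move=> i; exact: char_spanZ (uh i).
  - transitivity (s (\sum_(i <- js) u i) - two ^ j * \sum_(i <- js) u i).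
      rewrite rmorph_sum mulr_sumr -sumrB; apply: eq_bigr => i _.
      by rewrite (sH _ _ (uh i)) rmorphB mulrBl !cst_exprz [u i * _]mulrC.
    by rewrite -Es E subrr.
rewrite big_seq; apply: char_span_sum => i ijs.
have [<-|ij] := eqVneq i j; first exact: (uh i).
have /eqP := Z i ijs.
rewrite mulf_eq0 => /orP[|/eqP ->]; last exact: char_span0.
rewrite fmorph_eq0 subr_eq0 => /eqP /expr2z_inj E'.
by rewrite E' eqxx in ij.
Qed.

Lemma zX_span_deg_ge0 c m :
  char_span X (fun m' => 0 <= deg c m') (X m) -> 0 <= deg c m.
Proof.
move=> /(graded_decomposition c) [js [u [ujs uh Em js0]]].
case: lerP => // mneg; have mjs : deg c m \notin js.
  by apply/negP => /js0 [m' m'0 E]; rewrite -E ltNge m'0 in mneg.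
(* otherwise - z^m is the component of degree <c,m> in a sum that vanishes *)
pose v j := if j == deg c m then - X m else u j.
suff : v (deg c m) = 0.
  rewrite /v eqxx => /eqP; rewrite oppr_eq0 => /eqP E.
  by have := zX_neq0 k m; rewrite E eqxx.
have [s [Es sC sH]] := scale_rmorphism two_neq0 (of_degree_cst c _).
apply: (@graded_components c (fun f => f = 0) _ _ _ (deg c m :: js)).
- by move=> g h -> ->; rewrite subr0.
- by move=> b g ->; rewrite mulr0.
- by move=> g ->; rewrite Es rmorph0.
- by rewrite /= mjs.
- move=> j; rewrite /v; case: eqP => [->|_]; last exact: uh.
  rewrite -mulN1r -(rmorphN1 (@cst k n)); apply: char_spanZ.
  exact: of_degree_zX.
- rewrite big_cons {1}/v eqxx {1}Em addrC; apply/eqP; rewrite subr_eq0.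
  apply/eqP; rewrite big_seq [RHS]big_seq; apply: eq_bigr => j jjs.
  by rewrite /v; case: eqP => // jm; rewrite -jm jjs in mjs.
- exact: mem_head.
Qed.

Definition exchange p : F := 1 + X p.

Lemma exchangeE p : exchange p = 1 + X p.
Proof. by []. Qed.

Lemma laurent_exchange p : laurent (exchange p).
Proof. by apply: laurentD; [exact: laurent1 | exact: laurent_zX]. Qed.

Lemma of_degree_exchange c p : deg c p = 0 -> of_degree c 0 (exchange p).
Proof.
move=> cp; apply: char_spanD; last by rewrite -cp; exact: of_degree_zX.
by rewrite -(rmorph1 (@cst k n)); exact: of_degree_cst.
Qed.

(** Its value at the identity of the torus is 2. *)
Lemma exchange_neq0 p : exchange p != 0.
Proof.
apply: (specializes_neq0 (i := tofracT k n) (f := evaluation (fun=> 1))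
  (@tofracT_inj k n) two_neq0).
have -> : two = 1 + \prod_(i < n) 1 ^ p 0 i.
  by rewrite big1 => [|i _]; rewrite ?exp1rz // -(rmorph1 (@cst k n)) -rmorphD.
apply: (specializesD (@tofracT_inj k n)); first exact: specializes1.
by apply: specializes_zX => i; exact: oner_neq0.
Qed.

(** The Laurent polynomials that remain Laurent under the mutation for (p, c) are
    spanned by the products y (1 + z^p)^r with y homogeneous of degree at least
    - r: the mutation multiplies a component of degree j by (1 + z^p)^j, so for
    j < 0 that component has to be divisible by (1 + z^p)^(- j). *)
Lemma laurent_and_scale_ind p c (V : F -> Prop) : deg c p = 0 ->
  V 0 -> (forall f g, V f -> V g -> V (f + g)) ->
  (forall (j : int) (r : nat) y, of_degree c j y -> 0 <= j + r%:Z ->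
     V (y * exchange p ^+ r)) ->
  forall f, laurent f -> laurent (scale (exchange p) c f) -> V f.
Proof.
move=> cp V0 VD VB f Lf Ltf; have Bc := of_degree_exchange cp.
have B0 := exchange_neq0 p; set B := exchange p in B0 Bc VB Ltf *.
have [s [Es sC sH]] := scale_rmorphism two_neq0 (of_degree_cst c _).
have [t [Et tC tH]] := scale_rmorphism B0 Bc.
have [js [u [ujs uh Ef _]]] := graded_decomposition c Lf.
rewrite Ef big_seq; apply: big_ind => // j jjs.
(* the condition passes from f to its components *)
pose W f := laurent f /\ laurent (scale B c f).
have [] : W (u j).
  have Lth g : laurent g -> laurent (scale two c g).
    by apply: laurent_scale laurent_two; [exact: two_neq0 | exact: of_degree_cst].
  apply: (@graded_components c W _ _ _ js u ujs uh _ j jjs).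
  - move=> g h [Lg Ltg] [Lh Lsh]; split; first exact: laurentB.
    by rewrite Et rmorphB -!Et; exact: laurentB.
  - move=> a g [Lg Ltg]; split; first exact: char_spanZ.
    by rewrite Et rmorphM tC -Et; exact: char_spanZ.
  - move=> g [Lg Ltg]; split; first exact: Lth.
    rewrite scaleC; [exact: Lth|exact: B0|exact: two_neq0|exact: Bc|exact: Bc| |];
      exact: of_degree_cst.
  - by split; rewrite -Ef.
move=> Lu; rewrite Et (tH _ _ (uh j)) => LuB.
case: (lerP 0 j) => j0.
  by have := VB j 0%N _ (uh j); rewrite expr0 mulr1 addr0; apply.
have [r Ej] : exists r : nat, j = - r%:Z by exists `|j|%N; lia.
have -> : u j = u j * B ^ j * B ^+ r.
  by rewrite -mulrA Ej [B ^+ r]exprnP -expfzDr // addNr expr0z mulr1.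
apply: (VB j); last by rewrite Ej addNr.
apply: of_degreeP => //.
rewrite Es rmorphM fmorphXz (sH _ _ Bc) (sH _ _ (uh j)).
by rewrite expr0z mulr1 mulrAC mulrC.
Qed.

End Grading.
Opaque exchange.

(** * Two mutations in a row *)

Section Core.
Variables (k : fieldType) (hk : [pchar k] =i pred0) (n : nat).
Local Notation F := (torus_field k n).
Local Notation X := (@zX k n).
Local Notation laurent := (@laurentX k n).
Implicit Types (f g u x y : F) (m p : 'rV[int]_n) (c h : 'cV[int]_n).

Lemma laurent_zXz m (j : int) : laurent (X m ^ j).
Proof. by rewrite -zX_Mz; exact: laurent_zX. Qed.

Lemma laurent_subrX1 u (r : nat) : laurent u ->
  exists2 w, laurent w & u ^+ r - 1 = (u - 1) * w.
Proof.
move=> Lu; rewrite subrX1; eexists; last by [].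
by apply: char_span_sum => i _; exact: laurent_exp.
Qed.

Lemma clear_denominator x (j : int) : x != 0 ->
  exists M N : nat, x ^+ M * x ^ j = x ^+ N.
Proof.
move=> x0; case: j => j.
  by exists 0%N, j; rewrite expr0 mul1r.
exists j.+1, 0%N.
by rewrite [x ^+ j.+1]exprnP -expfzDr // NegzE subrr.
Qed.

(** If <h,p> = 1, then 1 + z^p generates the kernel of the evaluation
    z^m |-> (- z^(-p))^<h,m> z^m, which sets z^p equal to - 1.  The evaluation
    fixes u, so that (1 + z^p) y has value 0 as soon as u (1 + z^p) y has, and
    then 1 + z^p divides (1 + z^p) y in the ring of Laurent polynomials. *)
Lemma laurent_coprime p h y u : deg h p = 1 -> of_degree h 0 u -> u != 0 ->
  laurent (exchange k p * y) -> laurent (u * y) -> laurent y.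
Proof.
move=> hp hu u0 LAy Luy; set A := exchange k p in LAy *.
pose v : F := - X (- p).
have vE : v = - (X p)^-1 by rewrite /v zXN.
have v0 : v != 0 by rewrite vE oppr_eq0 invr_eq0; exact: zX_neq0.
have Lv : laurent v by apply: laurentN; exact: laurent_zX.
have LV : laurent v^-1.
  by rewrite vE invrN invrK; apply: laurentN; exact: laurent_zX.
have v1 : 1 - v = A * (X p)^-1.
  by rewrite vE opprK /A exchangeE mulrDl mul1r divff ?zX_neq0 // addrC.
have vr (r : nat) : exists2 w, laurent w & 1 - v ^+ r = A * w.
  have [w Lw E] := laurent_subrX1 r Lv; exists ((X p)^-1 * w).
    by apply: laurentM => //; rewrite -zXN; exact: laurent_zX.
  by rewrite mulrA -v1 -opprB E -mulNr opprB.
have vz (j : int) : exists2 w, laurent w & 1 - v ^ j = A * w.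
  case: j => r; first exact: vr.
  have [w Lw E] := vr r.+1; exists (- (v^-1 ^+ r.+1 * w)).
    by apply: laurentN; apply: laurentM => //; exact: laurent_exp.
  have vr0 : v ^+ r.+1 != 0 by rewrite expf_neq0.
  by rewrite NegzE -exprnN exprVn mulrN mulrCA -E mulrBr mulr1 (mulVf vr0) opprB.
pose sp := specializes (tofracT k n)
  (evaluation (fun i => Defs.coord k i * v ^ h i 0)).
have inj := @tofracT_inj k n.
(* g' is the value of g, and g - g' is a multiple of the exchange polynomial *)
have residue g : laurent g ->
    exists2 g', sp g g' & exists2 w, laurent w & g - g' = A * w.
  move: g; apply: char_span_ind => [|g1 g2 [g1' S1 [w1 L1 E1]] [g2' S2 [w2 L2 E2]]|a m _].
  - exists 0; first exact: specializes0.
    by exists 0; [exact: laurent0 | rewrite subr0 mulr0].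
  - exists (g1' + g2'); first exact: specializesD.
    exists (w1 + w2); first exact: laurentD.
    by rewrite opprD addrACA E1 E2 mulrDr.
  - exists (cst n a * (X m * v ^ deg h m)).
      apply: specializesM; first exact: specializes_cst.
      exact: specializes_scale_zX.
    have [w Lw E] := vz (deg h m); exists (cst n a * X m * w).
      apply: laurentM => //; apply: laurentM; first exact: laurent_cst.
      exact: laurent_zX.
    by rewrite [RHS]mulrCA -E mulrBr mulr1 mulrA.
have A0 : A != 0 by exact: exchange_neq0.
have SA : sp A 0.
  rewrite (_ : 0 = 1 + X p * v).
    apply: specializesD => //; first exact: specializes1.
    by have := specializes_scale_zX h p v0; rewrite hp expr1z.
  by rewrite vE mulrN divff ?zX_neq0 // subrr.
have [g' Sg [w Lw E]] := residue _ LAy.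
have [y' Sy _] := residue _ Luy.
have Su : sp u u.
  by have := specializes_scale_of_degree v0 hu; rewrite expr0z mulr1.
have S1 : sp (u * (A * y)) (u * g') by exact: specializesM.
have S2 : sp (u * (A * y)) 0.
  by rewrite mulrCA -(mul0r y'); exact: specializesM.
have /eqP := specializes_fun inj S1 S2.
rewrite mulf_eq0 (negbTE u0) /= => /eqP g'0.
by move: E; rewrite g'0 subr0 => /(mulfI A0) ->.
Qed.

(** Powers of u and of u - 1 generate the unit ideal. *)
Lemma laurent_comaximal u y (M N : nat) : laurent u ->
  laurent (u ^+ M * y) -> laurent ((u - 1) ^+ N * y) -> laurent y.
Proof.
move=> Lu; elim: M y => [|M IH] y; first by rewrite expr0 mul1r.
rewrite exprSr -mulrA => LM LN.
suff : laurent (u * y).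
  move=> Luy; move: (N) LN => N'; elim: N' => [|N' IHN]; first by rewrite expr0 mul1r.
  move=> LN; apply: IHN.
  rewrite (_ : _ * y = (u - 1) ^+ N' * (u * y) - (u - 1) ^+ N'.+1 * y).
    apply: laurentB => //; apply: laurentM => //; apply: laurent_exp.
    by apply: laurentB => //; exact: laurent1.
  by rewrite exprS; ring.
apply: IH => //; rewrite mulrCA; exact: laurentM.
Qed.

(** The heart of the proof.  The denominators of the result are bounded in two
    ways, by powers of A2 = 1 + z^p1 (1 + z^p2)^a and by powers of 1 + z^p2;
    these are comaximal when a > 0, and coprime when a = 0 and p1, p2 are
    separated by a covector h. *)
Lemma laurent_two_steps p1 p2 c1 c2 (a : nat) f :
  deg c1 p1 = 0 -> deg c2 p2 = 0 -> deg c2 p1 = a ->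
  (a = 0%N -> deg c1 p2 = 0 /\ exists2 h, deg h p1 = 1 & deg h p2 = 0) ->
  laurent f -> laurent (scale (exchange k p1) c1 f) ->
  laurent (scale (exchange k p2) c2 f) ->
  laurent (scale (exchange k p2) c2 (scale (exchange k p1) c1 f)).
Proof.
move=> c1p1 c2p2 c2p1 Ha Lf Lsf Ltf.
set A := exchange k p1 in Lsf *; set B := exchange k p2 in Ltf *.
have A0 : A != 0 by exact: exchange_neq0.
have B0 : B != 0 by exact: exchange_neq0.
have Ac := of_degree_exchange k c1p1; have Bc := of_degree_exchange k c2p2.
have [s [Es sC sH]] := scale_rmorphism A0 Ac.
have [t [Et tC tH]] := scale_rmorphism B0 Bc.
have LA : laurent A by exact: laurent_exchange.
have LB : laurent B by exact: laurent_exchange.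
have sX m : s (X m) = X m * A ^ deg c1 m by rewrite (sH _ _ (of_degree_zX k c1 m)).
have tX m : t (X m) = X m * B ^ deg c2 m by rewrite (tH _ _ (of_degree_zX k c2 m)).
pose A2 := 1 + X p1 * B ^+ a.
have tA : t A = A2 by rewrite /A exchangeE rmorphD rmorph1 tX c2p1.
have A20 : A2 != 0 by rewrite -tA fmorph_eq0.
have LA2 : laurent A2.
  apply: laurentD; first exact: laurent1.
  by apply: laurentM; [exact: laurent_zX | exact: laurent_exp].
have tsX m : t (s (X m)) = X m * B ^ deg c2 m * A2 ^ deg c1 m.
  by rewrite sX rmorphM tX fmorphXz tA.
(* A2 is 1 modulo B unless a = 0, so 1 + z^p2 A2^d is a multiple of B *)
have tsB : exists M g, laurent g /\ A2 ^+ M * t (s B) = B * g.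
  have E : t (s B) = 1 + X p2 * A2 ^ deg c1 p2.
    by rewrite /B exchangeE !rmorphD !rmorph1 tsX c2p2 expr0z mulr1.
  have A2X (r : nat) : a != 0%N -> exists2 w, laurent w & A2 ^+ r - 1 = B * w.
    move=> a0; have [w Lw ->] := laurent_subrX1 r LA2.
    exists (X p1 * B ^+ a.-1 * w).
      by apply: laurentM => //; apply: laurentM;
        [exact: laurent_zX | exact: laurent_exp].
    rewrite /A2 addrC addKr -[in LHS](prednK (_ : 0 < a)%N) ?lt0n // exprS.
    by rewrite !mulrA [X p1 * B]mulrC.
  case: (eqVneq a 0%N) => [a0|a0].
    have [d0 _] := Ha a0; exists 0%N, 1; split; first exact: laurent1.
    by rewrite E d0 expr0z expr0 mul1r !mulr1.
  rewrite E; case: (deg c1 p2) => d.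
    have [w Lw Ew] := A2X d a0; exists 0%N, (1 + X p2 * w); split.
      apply: laurentD; first exact: laurent1.
      by apply: laurentM => //; exact: laurent_zX.
    rewrite expr0 mul1r mulrDr mulr1 mulrCA -Ew mulrBr mulr1.
    by rewrite /B exchangeE [X in _ = _ + X]addrC addrA addrK.
  have [w Lw Ew] := A2X d.+1 a0; exists d.+1, (1 + w); split.
    by apply: laurentD => //; exact: laurent1.
  rewrite mulrDr mulr1 NegzE -exprnN mulrCA divff ?expf_neq0 // mulr1.
  by rewrite mulrDr mulr1 -Ew /B exchangeE; ring.
have tsy j y : of_degree c2 j y ->
    exists M g, laurent g /\ A2 ^+ M * t (s y) = B ^ j * g.
  move: y; apply: char_span_ind => [|y y' [M [g [Lg E]]] [M' [g' [Lg' E']]]|b m Hm].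
  - by exists 0%N, 0; split; [exact: laurent0 | rewrite !rmorph0 !mulr0].
  - exists (M + M')%N, (A2 ^+ M' * g + A2 ^+ M * g'); split.
      by apply: laurentD; apply: laurentM => //; exact: laurent_exp.
    rewrite !rmorphD exprD.
    rewrite [B ^ j * _]mulrDr [B ^ j * _]mulrCA -E [B ^ j * _]mulrCA -E'.
    by ring.
  - have [M [N E]] := clear_denominator (deg c1 m) A20.
    exists M, (cst n b * X m * A2 ^+ N); split.
      apply: laurentM; last exact: laurent_exp.
      by apply: laurentM; [exact: laurent_cst | exact: laurent_zX].
    rewrite (rmorphM s) (rmorphM t) sC tC tsX Hm -E.
    by move: (B ^ j) (A2 ^ _) (A2 ^+ M) => x1 x2 x3; ring.
have LNt g : laurent g -> exists N, laurent (B ^+ N * t g).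
  move: g; apply: char_span_ind => [|g g' [N L] [N' L']|b m _].
  - by exists 0%N; rewrite rmorph0 mulr0; exact: laurent0.
  - exists (N + N')%N; rewrite rmorphD mulrDr exprD.
    apply: laurentD; last by rewrite -mulrA; apply: laurentM => //; exact: laurent_exp.
    by rewrite mulrAC mulrC; apply: laurentM => //; exact: laurent_exp.
  - have [M [N E]] := clear_denominator (deg c2 m) B0.
    exists M; rewrite rmorphM tC tX mulrCA (mulrCA _ (X m)) E.
    apply: laurentM; first exact: laurent_cst.
    by apply: laurentM; [exact: laurent_zX | exact: laurent_exp].
(* first bound: only A2 occurs in the denominator *)
have [M LM] : exists M, laurent (A2 ^+ M * t (s f)).
  move: f Lf Ltf {Lsf}; apply: laurent_and_scale_ind => //.
  - by exists 0%N; rewrite !rmorph0 mulr0; exact: laurent0.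
  - move=> g g' [N L] [N' L'].
    exists (N + N')%N; rewrite !rmorphD mulrDr exprD.
    apply: laurentD; last by rewrite -mulrA; apply: laurentM => //; exact: laurent_exp.
    by rewrite mulrAC mulrC; apply: laurentM => //; exact: laurent_exp.
  - move=> j r y /tsy [M [g [Lg E]]] jr; have [M' [g' [Lg' E']]] := tsB.
    exists (M + M' * r)%N.
    have -> : A2 ^+ (M + M' * r) * t (s (y * B ^+ r)) =
        (A2 ^+ M * t (s y)) * (A2 ^+ M' * t (s B)) ^+ r.
      by rewrite !rmorphM !rmorphXn exprD exprM exprMn mulrACA.
    rewrite E E' exprMn mulrACA; apply: laurentM; last first.
      by apply: laurentM => //; exact: laurent_exp.
    rewrite [B ^+ r]exprnP -expfzDr //; case: (j + r%:Z) jr => // d _.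
    exact: laurent_exp.
(* second bound: only B occurs in the denominator *)
rewrite Es Et; rewrite Es in Lsf; have [N LN] := LNt _ Lsf.
case: (eqVneq a 0%N) => [a0|a0].
  have [_ [h hp1 hp2]] := Ha a0.
  have A2A : A2 = A by rewrite /A2 a0 expr0 mulr1.
  rewrite A2A in LM.
  have BN0 : B ^+ N != 0 := expf_neq0 N B0.
  have BNh : of_degree h 0 (B ^+ N).
    elim: {LN BN0} N => [|N IH].
      by rewrite expr0 -(rmorph1 (@cst k n)); exact: of_degree_cst.
    rewrite exprS -[0]addr0; apply: of_degreeM => //.
    exact: of_degree_exchange.
  elim: M LM => [|M IH]; first by rewrite expr0 mul1r.
  rewrite exprS -mulrA => LM; apply: IH.
  apply: (laurent_coprime hp1 BNh BN0 LM).
  by rewrite mulrCA; apply: laurentM => //; exact: laurent_exp.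
(* for a > 0, the power (A2 - 1)^N is a multiple of B^N *)
apply: (laurent_comaximal LA2 LM (N := N)).
rewrite /A2 addrC addKr exprMn -exprM.
rewrite (_ : _ * _ = X p1 ^+ N * B ^+ (a.-1 * N) * (B ^+ N * t (s f))).
  apply: laurentM => //; apply: laurentM; apply: laurent_exp => //.
  exact: laurent_zX.
rewrite -[in LHS](prednK (_ : 0 < a)%N) ?lt0n // mulSn exprD.
by rewrite [B ^+ N * B ^+ _]mulrC !mulrA.
Qed.

End Core.

Section Shear.
Variables (k : fieldType) (hk : [pchar k] =i pred0).

Section OneLattice.
Variable n : nat.
Local Notation F := (torus_field k n).
Local Notation X := (@zX k n).
Local Notation laurent := (@laurentX k n).
Implicit Types (f g : F) (m p : 'rV[int]_n) (c : 'cV[int]_n).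

Lemma of_degree_zX0 c p : deg c p = 0 -> of_degree c 0 (X p).
Proof. by move=> <-; exact: of_degree_zX. Qed.

Lemma rmorphism_ext_zX (s s' : {rmorphism F -> F}) :
  (forall a, s (cst n a) = s' (cst n a)) ->
  (forall m, s (X m) = s' (X m)) -> s =1 s'.
Proof.
by move=> sC sX; apply: rmorphism_ext => // i; rewrite -zX_delta; exact: sX.
Qed.

Lemma exchange_opp p : X p * exchange k (- p) = exchange k p.
Proof.
by rewrite !exchangeE mulrDr mulr1 zXN divff ?zX_neq0 // addrC.
Qed.

(** The factorisation 1 + z^p = z^p (1 + z^(-p)). *)
Lemma scale_shear p c f : deg c p = 0 ->
  scale (exchange k p) c f = scale (X p) c (scale (exchange k (- p)) c f).
Proof.
move=> cp; have cp' : deg c (- p) = 0 by rewrite degN cp oppr0.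
have [s [Es sC sH]] := scale_rmorphism (exchange_neq0 hk p) (of_degree_exchange k cp).
have [t [Et tC tH]] := scale_rmorphism (exchange_neq0 hk (- p)) (of_degree_exchange k cp').
have [v [Ev vC vH]] := scale_rmorphism (zX_neq0 k p) (of_degree_zX0 cp).
rewrite Es Et Ev; apply: (@rmorphism_ext_zX s (v \o t)) => [a|m] /=.
  by rewrite sC tC vC.
rewrite (sH _ _ (of_degree_zX k c m)) (tH _ _ (of_degree_zX k c m)).
rewrite (rmorphM v) (vH _ _ (of_degree_zX k c m)) fmorphXz.
rewrite (vH _ _ (of_degree_exchange k cp')) expr0z mulr1 -mulrA -expfzMl.
by rewrite exchange_opp.
Qed.

(** Mutating twice in the same direction is only a monomial change of
    coordinates. *)
Lemma scale_back p c f : deg c p = 0 ->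
  scale (exchange k (- p)) (- c) (scale (exchange k p) c f) = scale (X p) c f.
Proof.
move=> cp; rewrite (scale_shear _ cp).
have cp' : deg c (- p) = 0 by rewrite degN cp oppr0.
rewrite -(scaleC (k := k) _ (zX_neq0 k p) (exchange_neq0 hk (- p))).
- by rewrite (scaleK (exchange_neq0 hk _) (of_degree_exchange k cp')).
- exact: of_degree_zX0.
- by rewrite -[0]oppr0; apply: of_degreeN; exact: of_degree_zX0.
- exact: of_degree_exchange.
- by rewrite -[0]oppr0; apply: of_degreeN; exact: of_degree_exchange.
Qed.

Lemma laurent_shear p c f : deg c p = 0 -> laurent f -> laurent (scale (X p) c f).
Proof.
move=> cp; apply: laurent_scale; [exact: zX_neq0 | exact: of_degree_zX0 |].
exact: laurent_zXz.
Qed.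

Lemma laurent_back p c f : deg c p = 0 -> laurent f ->
  laurent (scale (exchange k (- p)) (- c) (scale (exchange k p) c f)).
Proof. by move=> cp Lf; rewrite scale_back //; exact: laurent_shear. Qed.

(** The vectors p2 + <c1,p2> p1 and c2 + a c1 are what the mutation rule makes of
    p2 and c2 when a > 0: they are the images of p2 and c2 under the monomial
    change of coordinates z^m |-> z^(m + <c1,m> p1). *)
Lemma shear_conjugate p1 p2 c1 c2 (a : int) f :
  deg c1 p1 = 0 -> deg c2 p2 = 0 -> deg c2 p1 = - a ->
  scale (exchange k (p2 + deg c1 p2 *: p1)) (c2 + a *: c1) (scale (X p1) c1 f)
  = scale (X p1) c1 (scale (exchange k p2) c2 f).
Proof.
move=> c1p1 c2p2 c2p1; set p := p2 + _; set c := c2 + _.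
have cp : deg c p = 0.
  rewrite /c /p deg_covecD deg_covecZ !degD !degZ c1p1 c2p2 c2p1.
  by rewrite mulr0 addr0 add0r mulrN mulrC addNr.
have [s [Es sC sH]] := scale_rmorphism (exchange_neq0 hk p) (of_degree_exchange k cp).
have [t [Et tC tH]] := scale_rmorphism (exchange_neq0 hk p2) (of_degree_exchange k c2p2).
have [v [Ev vC vH]] := scale_rmorphism (zX_neq0 k p1) (of_degree_zX0 c1p1).
rewrite Es Et !Ev; apply: (@rmorphism_ext_zX (s \o v) (v \o t)) => [b|m] /=.
  by rewrite vC sC tC vC.
have vp : v (exchange k p2) = exchange k p.
  rewrite !exchangeE rmorphD rmorph1 (vH _ _ (of_degree_zX k c1 p2)).
  by rewrite /p zXD zX_Mz.
rewrite (vH _ _ (of_degree_zX k c1 m)) (rmorphM s) fmorphXz.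
rewrite (sH _ _ (of_degree_zX k c m)) (sH _ _ (of_degree_zX k c p1)).
rewrite (tH _ _ (of_degree_zX k c2 m)) (rmorphM v) fmorphXz vp.
rewrite (vH _ _ (of_degree_zX k c1 m)) expfzMl exprz_exp.
have -> : deg c2 m = deg c m + deg c p1 * deg c1 m.
  rewrite !deg_covecD !deg_covecZ c1p1 c2p1 mulr0 addr0 mulNr.
  by rewrite -addrA subrr addr0.
rewrite (expfzDr _ _ (exchange_neq0 hk p)).
exact: mulrACA.
Qed.

(** For <c2,p1> = - a < 0, replacing p1 by - p1 gives the positive case; the
    monomial change of coordinates that this costs accounts exactly for the
    mutation of (p2, c2). *)
Lemma laurent_two_steps_neg p1 p2 c1 c2 (a : nat) f :
  deg c1 p1 = 0 -> deg c2 p2 = 0 -> deg c2 p1 = - a%:Z -> (0 < a)%N ->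
  laurent f -> laurent (scale (exchange k p1) c1 f) ->
  laurent (scale (exchange k p2) c2 f) ->
  laurent (scale (exchange k (p2 + deg c1 p2 *: p1)) (c2 + a%:Z *: c1)
    (scale (exchange k p1) c1 f)).
Proof.
move=> c1p1 c2p2 c2p1 a0 Lf Lsf Ltf.
have c1p1' : deg c1 (- p1) = 0 by rewrite degN c1p1 oppr0.
rewrite (scale_shear _ c1p1) (shear_conjugate _ c1p1 c2p2 c2p1).
apply: (laurent_shear c1p1).
apply: (laurent_two_steps hk (a := a) c1p1' c2p2 _ _ Lf _ Ltf).
- by rewrite degN c2p1 opprK.
- by move=> a0'; rewrite a0' in a0.
- have : laurent (scale (X p1) (- c1) (scale (exchange k p1) c1 f)).
    by apply: laurent_shear Lsf; rewrite deg_covecN c1p1 oppr0.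
  rewrite (scale_shear _ c1p1) (scaleK (zX_neq0 k p1) (of_degree_zX0 c1p1)).
  exact: id.
Qed.

End OneLattice.

(** * Setting the principal coefficients equal to 1 *)

Section Forget.
Variables n m : nat.
Local Notation laurent := (@laurentX k (n + m)).

Definition forget_coord (i : 'I_(n + m)) : torus_field k n :=
  match split i with inl j => Defs.coord k j | inr _ => 1 end.

Local Notation forget :=
  (specializes (tofracT k (n + m)) (evaluation forget_coord)).

Lemma forget_zX x : forget (zX k x) (zX k (lsubmx x)).
Proof.
have -> : zX k (lsubmx x) = \prod_i forget_coord i ^ x 0 i.
  rewrite big_split_ord /= [X in _ * X]big1 ?mulr1 => [|i _].
    rewrite zXE; apply: eq_bigr => i _.
    by rewrite /forget_coord (unsplitK (inl i)) mxE.
  by rewrite /forget_coord (unsplitK (inr i)) exp1rz.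
apply: specializes_zX => i; rewrite /forget_coord.
by case: (split i) => j; [exact: coord_neq0 | exact: oner_neq0].
Qed.

Lemma deg_col_mx0 (c : 'cV[int]_n) x :
  deg (col_mx c (0 : 'cV[int]_m)) x = deg c (lsubmx x).
Proof.
by rewrite !deg_mulmx -{1}[x]hsubmxK mul_row_col mulmx0 addr0.
Qed.

Lemma forget_laurent f g : laurent f -> forget f g -> laurentX g.
Proof.
move=> Lf Sg; suff [g' Sg' Lg'] : exists2 g', forget f g' & laurentX g'.
  by rewrite (specializes_fun (@tofracT_inj k _) Sg Sg').
move: f Lf {Sg}; apply: char_span_ind => [|f f' [g1 S1 L1] [g2 S2 L2]|a x _].
- by exists 0; [exact: specializes0 | exact: laurent0].
- exists (g1 + g2); last exact: laurentD.
  exact: (specializesD (@tofracT_inj k _)).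
- exists (cst n a * zX k (lsubmx x)).
    apply: specializesM; first exact: specializes_cst.
    exact: forget_zX.
  by apply: laurentM; [exact: laurent_cst | exact: laurent_zX].
Qed.

Lemma forget_exchange x : forget (exchange k x) (exchange k (lsubmx x)).
Proof.
rewrite !exchangeE; apply: (specializesD (@tofracT_inj k _)).
  exact: specializes1.
exact: forget_zX.
Qed.

(** On a Laurent polynomial f the mutated function is a sum of products of
    characters and integral powers of 1 + z^p, and 1 + z^p keeps a nonzero
    value; so each term can be specialised. *)
Lemma forget_scale p c f g : deg c (lsubmx p) = 0 ->
  laurent f -> forget f g ->
  forget (scale (exchange k p) (col_mx c 0) f)
         (scale (exchange k (lsubmx p)) c g).
Proof.
move=> cp Lf Sg; have cp' : deg (col_mx c 0) p = 0 by rewrite deg_col_mx0.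
have [s [Es sC sH]] := scale_rmorphism (exchange_neq0 hk p) (of_degree_exchange k cp').
have [t [Et tC tH]] := scale_rmorphism (exchange_neq0 hk (lsubmx p)) (of_degree_exchange k cp).
rewrite Es Et.
suff [g' Sg' Sg''] : exists2 g', forget f g' & forget (s f) (t g').
  by rewrite (specializes_fun (@tofracT_inj k _) Sg Sg').
move: f Lf {Sg}; apply: char_span_ind => [|f f' [g1 S1 L1] [g2 S2 L2]|a x _].
- by exists 0; rewrite ?rmorph0; exact: specializes0.
- by exists (g1 + g2); rewrite ?rmorphD; exact: (specializesD (@tofracT_inj k _)).
- exists (cst n a * zX k (lsubmx x)).
    apply: specializesM; first exact: specializes_cst.
    exact: forget_zX.
  rewrite (rmorphM s) (rmorphM t) sC tC (sH _ _ (of_degree_zX k (col_mx c 0) x)).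
  rewrite (tH _ _ (of_degree_zX k c (lsubmx x))) deg_col_mx0.
  apply: specializesM; first exact: specializes_cst.
  apply: specializesM; first exact: forget_zX.
  by apply: specializesXz; [exact: exchange_neq0 | exact: forget_exchange].
Qed.

End Forget.
End Shear.

(** * Mutation of seeds *)

Section Lattice.
Variables (n : nat) (P : 'rV[int]_n -> Prop).
Hypothesis PL : sublattice P.

Lemma sublatticeN x : P x -> P (- x).
Proof. by move=> Px; rewrite -sub0r; apply: PL.2 => //; exact: PL.1. Qed.

Lemma sublatticeD x y : P x -> P y -> P (x + y).
Proof. by move=> Px Py; rewrite -[y]opprK; apply: PL.2 => //; exact: sublatticeN. Qed.

Lemma sublatticeZ (a : int) x : P x -> P (a *: x).
Proof.
move=> Px; have H (r : nat) : P (r%:Z *: x).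
  elim: r => [|r IH]; first by rewrite scale0r; exact: PL.1.
  by rewrite (intS r) scalerDl scale1r; exact: sublatticeD.
by case: a => r //; rewrite NegzE scaleNr; apply: sublatticeN.
Qed.

Lemma is_basis_elementary (J : {set 'I_n}) (b b' : 'I_n -> 'rV[int]_n)
    (a : 'I_n -> int) j :
  j \in J -> b' j = - b j -> (forall i, i != j -> b' i = b i + a i *: b j) ->
  is_basis J b P -> is_basis J b' P.
Proof.
move=> jJ bj bi [Pb gen free]; split.
- move=> i iJ; have [->|ij] := eqVneq i j; first by rewrite bj; exact: sublatticeN (Pb _ jJ).
  rewrite bi //; apply: sublatticeD; first exact: Pb.
  by apply: sublatticeZ; exact: Pb.
- move=> x /gen [c ->].
  (* b j = - b' j also collects the terms - a i b j of the other b i *)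
  pose t := \sum_(i in J | i != j) c i * a i.
  exists (fun i => if i == j then t - c j else c i).
  rewrite (bigD1 j) //= [RHS](bigD1 j) //= eqxx bj.
  under [X in _ = _ + X]eq_bigr => i /andP[_ ij].
    rewrite (negbTE ij) bi // scalerDr scalerA; over.
  rewrite big_split /= -scaler_suml scalerN scalerBl -/t opprB.
  by rewrite [X in _ = _ + X]addrC addrA subrK.
- move=> c E.
  pose t := \sum_(i in J | i != j) c i * a i.
  have H : forall i, i \in J -> (if i == j then t - c j else c i) = 0.
    apply: free; apply: etrans E; rewrite (bigD1 j) //= [RHS](bigD1 j) //= eqxx bj.
    under [X in _ = _ + X]eq_bigr => i /andP[_ ij].
      rewrite bi // scalerDr scalerA; over.
    rewrite big_split /= -scaler_suml scalerN scalerBl -/t.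
    rewrite [X in _ = _ + X]addrC addrA [_ *: _ - _]addrC; congr (_ + _).
    by apply: eq_bigr => i /andP[_ /negbTE ->].
  have Hi i : i \in J -> i != j -> c i = 0.
    by move=> iJ ij; have := H i iJ; rewrite (negbTE ij).
  move=> i iJ; have [->|ij] := eqVneq i j; last exact: Hi.
  have := H j jJ; rewrite eqxx /t big1 ?sub0r => [/eqP|l /andP[lJ lj]].
    by rewrite oppr_eq0 => /eqP.
  by rewrite Hi // mul0r.
Qed.

End Lattice.

Section Seeds.
Variables (n : nat) (D : fixed_data n).
Local Notation d i := (dd D i).
Local Notation form := Defs.form.
Implicit Types (x y z : 'rV[int]_n) (e : 'I_n -> 'rV[int]_n).

Lemma skew0l z : form D 0 z = 0.
Proof. by have := form_linearl D (-1) z z z; rewrite scaleN1r addNr mulN1r addNr. Qed.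

Lemma skewZl (a : int) x z : form D (a *: x) z = a%:~R * form D x z.
Proof. by rewrite -[a *: x]addr0 form_linearl skew0l addr0. Qed.

Lemma skewZr (a : int) x z : form D z (a *: x) = a%:~R * form D z x.
Proof. by rewrite form_skew skewZl form_skew mulrN opprK. Qed.

Lemma skew_suml (I : finType) (c : I -> int) (b : I -> 'rV[int]_n) z :
  form D (\sum_i c i *: b i) z = \sum_i (c i)%:~R * form D (b i) z.
Proof.
elim/big_rec2: _ => [|i y1 y2 _ <-]; first exact: skew0l.
by rewrite form_linearl.
Qed.

Lemma max0_int (r : rat) : r \is a Num.int -> Num.max 0 r \is a Num.int.
Proof. by move=> ri; case: lerP. Qed.

Section Seed.
Variable e : 'I_n -> 'rV[int]_n.
Hypothesis he : is_seed D e.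

Lemma seed_Nuf i : i \in Iuf D -> Nuf D (e i).
Proof. by case: he => _ [H _ _] _; exact: H. Qed.

Lemma seed_No i : No D ((d i)%:Z *: e i).
Proof. by case: he => _ _ [H _ _]; apply: H; exact: in_setT. Qed.

Lemma seed_Nuf_No i : i \in Iuf D -> Nuf D ((d i)%:Z *: e i).
Proof. by move=> iJ; apply: sublatticeZ (seed_Nuf iJ); exact: Nuf_sublattice. Qed.

Lemma seed_form_int i j : j \in Iuf D -> form D (e i) (e j) * (d j)%:R \is a Num.int.
Proof.
move=> jJ; have := form_N_NufNo (e i) (seed_Nuf_No jJ) (seed_No j).
by rewrite skewZr mulrC.
Qed.

Lemma seed_form_int_dd i j : j \in Iuf D -> form D (e i) (e j) * (d i)%:R \is a Num.int.
Proof.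
move=> jJ; have := form_Nuf_No (seed_Nuf jJ) (seed_No i).
by rewrite skewZr mulrC form_skew mulNr rpredN.
Qed.

(** The number d_i [eps_ij]_+ is an integral multiple of d_j, so that the vectors
    d_i e_i of a mutated seed are obtained from those of the seed by an
    elementary transformation over the integers. *)
Lemma dd_mut_coef i j : j \in Iuf D ->
  (d i)%:Z * numq (Num.max 0 (form D (e i) (e j) * (d j)%:R))
  = numq (Num.max 0 (form D (e i) (e j) * (d i)%:R)) * (d j)%:Z.
Proof.
move=> jJ; apply: (@intr_inj rat); rewrite !intrM.
rewrite !numqK ?max0_int ?seed_form_int ?seed_form_int_dd //.
rewrite mulrC !maxr_pMl ?ler0n // !mul0r -!mulrA.
by rewrite [(d j)%:~R * _]mulrC.
Qed.

Lemma mut_seed_is_seed j : j \in Iuf D -> is_seed D (mut_seed D e j).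
Proof.
move=> jJ; case: (he) => b1 b2 b3.
pose a i := numq (Num.max 0 (form D (e i) (e j) * (d j)%:R)).
pose r i := numq (Num.max 0 (form D (e i) (e j) * (d i)%:R)).
have ej : mut_seed D e j j = - e j by rewrite /mut_seed eqxx.
have ei i : i != j -> mut_seed D e j i = e i + a i *: e j.
  by move=> ij; rewrite /mut_seed (negbTE ij).
split.
- by apply: (@is_basis_elementary n _ _ _ _ _ a j _ ej ei b1).
- exact: (@is_basis_elementary n _ (Nuf_sublattice D) _ _ _ a j jJ ej ei b2).
- apply: (@is_basis_elementary n _ (No_sublattice D) _ _ _ r j _ _ _ b3) => //.
    by rewrite ej scalerN.
  by move=> i ij; rewrite (ei i ij) scalerDr !scalerA (dd_mut_coef i jJ).
Qed.

Lemma seed_matrix_inverse : exists C : 'M[int]_n, (\matrix_i e i) *m C = 1%:M.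
Proof.
case: he => -[_ gen _] _ _.
have /fin_all_exists [c Hc] (l : 'I_n) : exists c : 'I_n -> int,
    delta_mx 0 l = \sum_i c i *: e i :> 'rV[int]_n.
  by have [c Ec] := gen (delta_mx 0 l) I; exists c; rewrite Ec; apply: eq_bigl => i; rewrite in_setT.
exists (\matrix_(l, i) c l i); apply: mulmx1C; apply/row_matrixP => l.
rewrite row_mul row1 Hc mulmx_sum_row; apply: eq_bigr => i _.
by rewrite rowK !mxE.
Qed.

(** Covectors separating the vectors of a seed, which make their exchange
    polynomials coprime. *)
Lemma seed_dual j : exists2 h : 'cV[int]_n,
  deg h (e j) = 1 & forall i, i != j -> deg h (e i) = 0.
Proof.
have [C EC] := seed_matrix_inverse; have H i : deg (col j C) (e i) = (i == j)%:R.
  move/matrixP: EC => /(_ i j); rewrite !mxE => <-; rewrite degE.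
  by apply: eq_bigr => l _; rewrite !mxE.
by exists (col j C) => [|i ij]; rewrite H ?eqxx // (negbTE ij).
Qed.

End Seed.
End Seeds.

(** * The Laurent phenomenon with principal coefficients *)

Section PrincipalCoefficients.
Variables (k : fieldType) (hk : [pchar k] =i pred0) (n m : nat).
Variable D : fixed_data n.
Local Notation d i := (dd D i).
Local Notation form := Defs.form.
Local Notation J := (Iuf D).
Variables (phi : 'rV[int]_n -> 'rV[int]_m) (psi : 'rV[int]_n -> 'cV[int]_m).
Hypothesis phi_linear : forall (a : int) x y,
  Nuf D x -> Nuf D y -> phi (a *: x + y) = a *: phi x + phi y.
Hypothesis psi_linear : forall (a : int) x y,
  Nuf D x -> No D x -> Nuf D y -> No D y ->
  psi (a *: x + y) = a *: psi x + psi y.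
Hypothesis phi_psi : forall x y, Nuf D x -> Nuf D y -> No D y ->
  (deg (psi y) (phi x))%:~R = form D x y.
Implicit Type e : 'I_n -> 'rV[int]_n.

(** The last n coordinates are those of the principal coefficients.  Their
    covectors vanish, so the degrees <c_j, p_i> are unchanged, while the e_i
    make the vectors linearly independent. *)
Definition principal_vec e i : 'rV[int]_(m + n) := row_mx (phi (e i)) (e i).

Definition covec e i : 'cV[int]_m := psi ((d i)%:Z *: e i).

Definition principal_covec e i : 'cV[int]_(m + n) := col_mx (covec e i) 0.

Lemma Nuf0 : Nuf D 0. Proof. exact: (Nuf_sublattice D).1. Qed.
Lemma No0 : No D 0. Proof. exact: (No_sublattice D).1. Qed.

Lemma phi0 : phi 0 = 0.
Proof.
have := phi_linear (-1) Nuf0 Nuf0.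
by rewrite scaleN1r oppr0 addr0 scaleN1r addNr.
Qed.

Lemma psi0 : psi 0 = 0.
Proof.
have := psi_linear (-1) Nuf0 No0 Nuf0 No0.
by rewrite scaleN1r oppr0 addr0 scaleN1r addNr.
Qed.

Lemma phiN x : Nuf D x -> phi (- x) = - phi x.
Proof.
by move=> xN; rewrite -scaleN1r -[X in phi X]addr0 phi_linear ?phi0 ?addr0 ?scaleN1r //; exact: Nuf0.
Qed.

Lemma psiN x : Nuf D x -> No D x -> psi (- x) = - psi x.
Proof.
move=> xN xo; rewrite -scaleN1r -[X in psi X]addr0 psi_linear //; try exact: Nuf0; try exact: No0.
by rewrite psi0 addr0 scaleN1r.
Qed.

Lemma deg_principal e i x :
  deg (principal_covec e i) x = deg (covec e i) (lsubmx x).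
Proof. exact: deg_col_mx0. Qed.

Lemma deg_seed e i j : is_seed D e -> i \in J -> j \in J ->
  (deg (covec e j) (phi (e i)))%:~R = form D (e i) (e j) * (d j)%:R.
Proof.
move=> he iJ jJ; rewrite /covec phi_psi; first by rewrite skewZr mulrC.
- exact: seed_Nuf he _ iJ.
- exact: seed_Nuf_No he _ jJ.
- exact: seed_No he j.
Qed.

Lemma deg_seed0 e i : is_seed D e -> i \in J -> deg (covec e i) (phi (e i)) = 0.
Proof.
move=> he iJ; apply/eqP; rewrite -(intr_eq0 rat) deg_seed //.
suff -> : form D (e i) (e i) = 0 by rewrite mul0r.
by apply/eqP; rewrite -eqNr -form_skew.
Qed.

Definition upper_bound e (f : torus_field k (m + n)) : Prop :=
  laurentX f /\ forall i, i \in J ->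
    laurentX (scale (exchange k (principal_vec e i)) (principal_covec e i) f).

(** Direction j itself leads back by a monomial change of coordinates.  Another
    direction i is unchanged by the mutation if {e_i, e_j} <= 0, which is the
    case <c_i, p_j> >= 0 of two successive mutations; if {e_i, e_j} > 0, the
    mutated vectors are those of the case <c_i, p_j> < 0. *)
Lemma upper_bound_mut e j f : is_seed D e -> j \in J -> upper_bound e f ->
  upper_bound (mut_seed D e j)
    (scale (exchange k (principal_vec e j)) (principal_covec e j) f).
Proof.
move=> he jJ [Lf Ls]; split; first exact: Ls.
have degE' i l : deg (principal_covec e l) (principal_vec e i) =
    deg (covec e l) (phi (e i)) by rewrite deg_principal row_mxKl.
have d0 i : i \in J -> deg (principal_covec e i) (principal_vec e i) = 0.
  by move=> iJ; rewrite degE' deg_seed0.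
move=> i iJ; have [->|ij] := eqVneq i j.
  have -> : principal_vec (mut_seed D e j) j = - principal_vec e j.
    rewrite /principal_vec /mut_seed eqxx opp_row_mx phiN //.
    exact: seed_Nuf he _ jJ.
  have -> : principal_covec (mut_seed D e j) j = - principal_covec e j.
    rewrite /principal_covec /covec /mut_seed eqxx opp_col_mx oppr0 scalerN.
    rewrite psiN //; [exact: seed_Nuf_No he _ jJ | exact: seed_No he j].
  exact: laurent_back (d0 j jJ) Lf.
pose c := form D (e i) (e j).
have cj : (deg (covec e j) (phi (e i)))%:~R = c * (d j)%:R by exact: deg_seed.
have ci : (deg (covec e i) (phi (e j)))%:~R = - c * (d i)%:R.
  by rewrite deg_seed // form_skew.
have dp l : 0 < (d l)%:R :> rat by rewrite ltr0n; exact: dd_gt0.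
have [c0|c0] := lerP c 0.
  have ei : mut_seed D e j i = e i.
    rewrite /mut_seed (negbTE ij) max_l; last by rewrite pmulr_lle0.
    by rewrite scale0r addr0.
  rewrite /principal_vec /principal_covec /covec ei -/(covec e i).
  have : 0 <= deg (covec e i) (phi (e j)).
    by rewrite -(ler0z rat) ci mulNr oppr_ge0 pmulr_lle0.
  case Ea : (deg (covec e i) (phi (e j))) => [a|//] _.
  apply: (laurent_two_steps hk (a := a) (d0 j jJ) (d0 i iJ) _ _ Lf (Ls j jJ) (Ls i iJ)).
    by rewrite degE' Ea.
  move=> a0; have c0' : c = 0.
    move/eqP: ci; rewrite Ea a0 eq_sym mulf_eq0 oppr_eq0 => /orP[/eqP //|].
    by rewrite (gt_eqF (dp i)).
  split.
    by rewrite degE'; apply/eqP; rewrite -(intr_eq0 rat) cj c0' mul0r.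
  have [h hj hi] := seed_dual he j.
  exists (col_mx 0 h).
    by rewrite deg_mulmx mul_row_col mulmx0 add0r -deg_mulmx.
  by rewrite deg_mulmx mul_row_col mulmx0 add0r -deg_mulmx hi.
have ei : mut_seed D e j i = deg (covec e j) (phi (e i)) *: e j + e i.
  rewrite /mut_seed (negbTE ij) max_r; last by rewrite ltW // pmulr_lgt0.
  by rewrite -/c -cj numq_int addrC.
have : deg (covec e i) (phi (e j)) < 0.
  by rewrite -(ltrz0 rat) ci mulNr oppr_lt0 pmulr_lgt0.
case Ea : (deg (covec e i) (phi (e j))) => [//|a] _.
have Ead : a.+1%:Z * (d j)%:Z = (d i)%:Z * deg (covec e j) (phi (e i)).
  apply: (@intr_inj rat); rewrite !intrM cj.
  move: ci; rewrite Ea NegzE intrN mulNr => /oppr_inj ->.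
  by rewrite mulrAC mulrC [c * _]mulrC mulrA.
have -> : principal_vec (mut_seed D e j) i = principal_vec e i +
    deg (principal_covec e j) (principal_vec e i) *: principal_vec e j.
  rewrite degE' /principal_vec ei scale_row_mx add_row_mx.
  rewrite phi_linear; [|exact: seed_Nuf he _ jJ|exact: seed_Nuf he _ iJ].
  by congr row_mx; rewrite addrC.
have -> : principal_covec (mut_seed D e j) i =
    principal_covec e i + a.+1%:Z *: principal_covec e j.
  rewrite /principal_covec scale_col_mx add_col_mx scaler0 addr0.
  congr col_mx; rewrite /covec ei scalerDr scalerA -Ead -scalerA psi_linear.
  - by rewrite addrC.
  - exact: seed_Nuf_No he _ jJ.
  - exact: seed_No he j.
  - exact: seed_Nuf_No he _ iJ.
  - exact: seed_No he i.
apply: (laurent_two_steps_neg hk (d0 j jJ) (d0 i iJ) _ _ Lf (Ls j jJ) (Ls i iJ)) => //.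
by rewrite degE' Ea NegzE.
Qed.

Variable mu_inv : ('I_n -> 'rV[int]_n) -> 'I_n -> torus_field k m -> torus_field k m.
Hypothesis mu_invE : forall e j f, is_seed D e -> j \in J ->
  mu_inv e j f = scale (exchange k (phi (e j))) (covec e j) f.

Local Notation forget :=
  (specializes (tofracT k (m + n)) (evaluation (@forget_coord k m n))).

(** f is a lift of g to principal coefficients; the invariant of the induction is
    the upper bound for the lift, since without coefficients the upper bound
    does not propagate. *)
Lemma upper_bound_pull_up w e f g : is_seed D e -> vertex D w ->
  upper_bound e f -> forget f g -> laurentX (pull_up D mu_inv e w g).
Proof.
elim: w e f g => [|j w IH] e f g he; first by move=> _ [Lf _]; exact: forget_laurent.
move=> /= /andP[jJ wJ] Uf Sg; rewrite mu_invE //.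
apply: (IH _ _ _ (mut_seed_is_seed he jJ) wJ (upper_bound_mut he jJ Uf)).
have := @forget_scale k hk m n (principal_vec e j) (covec e j) f g.
rewrite row_mxKl; apply => //; first exact: deg_seed0.
by case: Uf.
Qed.

Lemma laurent_phenomenon w e q : is_seed D e -> vertex D w ->
  (forall i, i \in J -> 0 <= deg (covec e i) q) ->
  laurentX (pull_up D mu_inv e w (zX k q)).
Proof.
move=> he wJ q0; apply: (upper_bound_pull_up (f := zX k (row_mx q 0)) he wJ).
  split; first exact: laurent_zX.
  move=> i iJ; have d0 : deg (principal_covec e i) (principal_vec e i) = 0.
    by rewrite deg_principal row_mxKl deg_seed0.
  rewrite (scaleX (exchange_neq0 hk _) (of_degree_exchange k d0)).
  rewrite deg_principal row_mxKl; case: (deg _ _) (q0 i iJ) => // r _.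
  apply: laurentM; first exact: laurent_zX.
  by apply: laurent_exp; exact: laurent_exchange.
by have := @forget_zX k m n (row_mx q 0); rewrite row_mxKl.
Qed.

End PrincipalCoefficients.

(** * Gluing along the tree *)

Section Gluing.
Variables (n : nat) (D : fixed_data n) (F : Type).
Variables (mu mu_inv : ('I_n -> 'rV[int]_n) -> 'I_n -> F -> F).
Hypothesis muK : forall e j, is_seed D e -> j \in Iuf D ->
  cancel (mu_inv e j) (mu e j).
Variables (regular : F -> Prop) (trans : seq 'I_n -> seq 'I_n -> F -> F).
Variable e : 'I_n -> 'rV[int]_n.
Hypothesis he : is_seed D e.
Hypothesis transE : forall w w' f, trans w w' f =
  let: (u, a, b) := fork w w' in
  pull_up D mu_inv (seed_at D e u) a (pull_down D mu (seed_at D e u) b f).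

Lemma fork_cat (T : eqType) (w w' u a b : seq T) :
  fork w w' = (u, a, b) -> w = u ++ a /\ w' = u ++ b.
Proof.
elim: w w' u a b => [|x t IH] [|y t'] u a b //=; try by case=> <- <- <-.
case: eqP => [<-|_]; last by case=> <- <- <-.
by case E: (fork t t') => [[u' a'] b'] [<- <- <-]; have [-> ->] := IH _ _ _ _ E.
Qed.

Lemma pull_up_cat e' u a f : pull_up D mu_inv e' (u ++ a) f =
  pull_up D mu_inv (seed_at D e' u) a (pull_up D mu_inv e' u f).
Proof. by elim: u e' f => //= j u IH e' f; rewrite IH. Qed.

Lemma seed_at_is_seed u : vertex D u -> is_seed D (seed_at D e u).
Proof.
elim/last_ind: u => [//|u j IH].
rewrite /vertex all_rcons => /andP[jJ uJ].
by rewrite /seed_at foldl_rcons; apply: mut_seed_is_seed => //; exact: IH.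
Qed.

Lemma pull_downK e' b f : is_seed D e' -> vertex D b ->
  pull_down D mu e' b (pull_up D mu_inv e' b f) = f.
Proof.
elim: b e' f => [//|j b IH] e' f he' /= /andP[jJ bJ].
rewrite IH //; last exact: mut_seed_is_seed.
exact: muK.
Qed.

Lemma trans_root w f : trans w [::] f = pull_up D mu_inv e w f.
Proof. by rewrite transE; case: w. Qed.

(** If w = u ++ a and w' = u ++ b, going from w' up to the fork u undoes the
    mutations along b, which leaves the expression at u, and the mutations
    along a then give the expression at w. *)
Lemma glued_section_root f :
  (forall w, vertex D w -> regular (pull_up D mu_inv e w f)) ->
  glued_section D regular trans (fun w => trans w [::] f).
Proof.
move=> reg; split=> [w wJ|w w' wJ w'J]; first by rewrite trans_root; exact: reg.
rewrite !trans_root transE; case E: (fork w w') => [[u a] b].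
have [Ew Ew'] := fork_cat E; move: wJ w'J; rewrite Ew Ew' /vertex !all_cat.
move=> /andP[uJ aJ] /andP[_ bJ].
by rewrite !pull_up_cat pull_downK //; exact: seed_at_is_seed.
Qed.

End Gluing.

(** * The two cluster varieties *)

Lemma char_span_mono (k : fieldType) n (L : Type) (z : L -> torus_field k n)
    (P Q : L -> Prop) f :
  (forall m, P m -> Q m) -> char_span z P f -> char_span z Q f.
Proof. by move=> PQ [r [c [m [Pm ->]]]]; exists r, c, m; split=> // j; exact: PQ. Qed.

Section Pairing.
Variables (n : nat) (D : fixed_data n).
Local Notation pairing := Defs.pairing.
Local Notation form := Defs.form.
Implicit Types (x y : 'rV[int]_n) (m : 'rV[rat]_n).

Definition form_vec x : 'rV[rat]_n := \row_j form D x (delta_mx 0 j).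

Lemma pairing_form_vec x y : pairing y (form_vec x) = form D x y.
Proof.
rewrite form_skew [in RHS](row_sum_delta y) skew_suml -sumrN.
by apply: eq_bigr => i _; rewrite mxE form_skew mulrN.
Qed.

Lemma pairingZl (a : int) y m : pairing (a *: y) m = a%:~R * pairing y m.
Proof.
by rewrite mulr_sumr; apply: eq_bigr => i _; rewrite mxE intrM mulrA.
Qed.

Lemma pairingDl x y m : pairing (x + y) m = pairing x m + pairing y m.
Proof.
by rewrite -big_split; apply: eq_bigr => i _; rewrite mxE intrD mulrDl.
Qed.

Lemma pairingDr y m m' : pairing y (m + m') = pairing y m + pairing y m'.
Proof. by rewrite -big_split; apply: eq_bigr => i _; rewrite mxE mulrDr. Qed.

Lemma pairingZr a y m : pairing y (a *: m) = a * pairing y m.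
Proof.
by rewrite mulr_sumr; apply: eq_bigr => i _; rewrite mxE mulrCA.
Qed.

Lemma pairing0l m : pairing 0 m = 0.
Proof. by rewrite -[0 in LHS](scale0r 0) pairingZl mul0r. Qed.

Lemma pairing_suml (I : finType) (c : I -> int) (b : I -> 'rV[int]_n) m :
  pairing (\sum_i c i *: b i) m = \sum_i (c i)%:~R * pairing (b i) m.
Proof.
elim/big_rec2: _ => [|i y1 y2 _ <-]; first exact: pairing0l.
by rewrite pairingDl pairingZl.
Qed.

Lemma numq_linear (a : int) (r s : rat) : r \is a Num.int -> s \is a Num.int ->
  numq (a%:~R * r + s) = a * numq r + numq s.
Proof.
move=> ri si; apply: (@intr_inj rat); rewrite intrD intrM !numqK //.
by rewrite rpredD // rpredM // intr_int.
Qed.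

End Pairing.

Section XSide.
Variables (k : fieldType) (hk : [pchar k] =i pred0) (n : nat).
Variable D : fixed_data n.
Local Notation d i := (dd D i).
Local Notation form := Defs.form.
Local Notation pairing := Defs.pairing.
Local Notation J := (Iuf D).
Implicit Type e : 'I_n -> 'rV[int]_n.

(** The covector {-, y}; for y = d_k e_k it is [-, e_k]. *)
Definition psiX (y : 'rV[int]_n) : 'cV[int]_n :=
  \col_i numq (form D (delta_mx 0 i) y).

Lemma psiX_linear (a : int) x y : Nuf D x -> No D x -> Nuf D y -> No D y ->
  psiX (a *: x + y) = a *: psiX x + psiX y.
Proof.
move=> xN xo yN yo; apply/colP => i; rewrite !mxE form_linearr numq_linear //.
  exact: form_N_NufNo xN xo.
exact: form_N_NufNo yN yo.
Qed.

Lemma deg_psiX x y : Nuf D y -> No D y -> (deg (psiX y) x)%:~R = form D x y.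
Proof.
move=> yN yo; rewrite degE rmorph_sum [in RHS](row_sum_delta x) skew_suml.
apply: eq_bigr => i _; rewrite mxE rmorphM /= numqK //.
exact: form_N_NufNo yN yo.
Qed.

Local Notation covecX := (covec D psiX).

Lemma brX_delta e j i : brX D e j (delta_mx 0 i) = covecX e j i 0.
Proof. by rewrite /brX /covec mxE skewZr mulrC. Qed.

Lemma mutX_invE e j (f : torus_field k n) :
  mutX_inv D e j f = scale (exchange k (e j)) (covecX e j) f.
Proof.
by apply: subst_eq => i; rewrite zX_delta -exchangeE brX_delta.
Qed.

Lemma mutXE e j (f : torus_field k n) :
  mutX D e j f = scale (exchange k (e j)) (- covecX e j) f.
Proof.
by apply: subst_eq => i; rewrite zX_delta -exchangeE brX_delta [(- covecX e j) i 0]mxE.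
Qed.

(** The condition on q in the theorem, in terms of covectors: both sides are
    d_i {q, e_i}. *)
Lemma deg_covecX e i q : is_seed D e -> i \in J ->
  (deg (covecX e i) q)%:~R = (d i)%:R * pairing q (- vvec D e i).
Proof.
move=> he iJ; rewrite /covec deg_psiX; last exact: seed_No he i.
  rewrite skewZr -scaleN1r pairingZr (pairing_form_vec D (e i) q).
  by rewrite mulN1r -form_skew.
exact: seed_Nuf_No he _ iJ.
Qed.

Lemma deg_covecX_ge0 e i q : is_seed D e -> i \in J ->
  (0 <= deg (covecX e i) q) = (0 <= pairing q (- vvec D e i)).
Proof.
by move=> he iJ; rewrite -(ler0z rat) deg_covecX // pmulr_rge0 // ltr0n dd_gt0.
Qed.

Lemma deg_covecX_self e j : is_seed D e -> j \in J -> deg (covecX e j) (e j) = 0.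
Proof. exact: (@deg_seed0 n n D id psiX (fun x y _ => @deg_psiX x y)). Qed.

Lemma laurentX_phenomenon e q w : is_seed D e -> vertex D w ->
  (forall i, i \in J -> 0 <= pairing q (- vvec D e i)) ->
  laurentX (pull_up D (@mutX_inv k n D) e w (zX k q)).
Proof.
move=> he wJ q0.
apply: (@laurent_phenomenon k hk n n D id psiX _ _ _ _ _ w e q he wJ).
- by [].
- exact: psiX_linear.
- by move=> x y _; exact: deg_psiX.
- by move=> e' j f _ _; exact: mutX_invE.
- by move=> i iJ; rewrite deg_covecX_ge0 // q0.
Qed.

Lemma mutXK e j : is_seed D e -> j \in J ->
  cancel (@mutX_inv k n D e j) (@mutX k n D e j).
Proof.
move=> he jJ f; rewrite mutX_invE mutXE.
apply: (scaleK (exchange_neq0 hk _)).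
by apply: of_degree_exchange; exact: deg_covecX_self.
Qed.

Lemma H0X_zX e q : is_seed D e ->
  (forall i, i \in J -> 0 <= pairing q (- vvec D e i)) ->
  H0X D e (ratX D e (zX k q)).
Proof.
move=> he q0; apply: (glued_section_root (mu := @mutX k n D)
  (mu_inv := @mutX_inv k n D) mutXK he) => // w wJ.
exact: laurentX_phenomenon.
Qed.

Section Toric.
Variable R : realType.

Lemma ev_rayX e i (x : 'rV[int]_n) t :
  \sum_l (x 0 l)%:~R * (t *: (- map_mx ratr ((d i)%:R *: vvec D e i) : 'rV[R]_n)) 0 l
  = t * (d i)%:R * ratr (pairing x (- vvec D e i)).
Proof.
rewrite rmorph_sum mulr_sumr; apply: eq_bigr => l _.
by rewrite !mxE !rmorphM !rmorphN /= ratr_int ratr_nat; ring.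
Qed.

(** If z^q is regular on the chart of the i-th ray, it is a combination of
    characters of nonnegative i-th degree, hence has nonnegative degree. *)
Lemma TV_X_regularP e q : is_seed D e ->
  (forall i, i \in J -> 0 <= pairing q (- vvec D e i)) <->
  TV_X_regular R D e (zX k q).
Proof.
move=> he; split=> [q0 sigma Hs|reg i iJ].
  rewrite -[zX k q]mul1r -(rmorph1 (@cst k n)); apply: char_span_char.
  split=> // u; case: Hs => [->->|[i iJ ->] [t t0 ->]].
    by rewrite big1 // => l _; rewrite mxE mulr0.
  rewrite ev_rayX; apply: mulr_ge0; last by rewrite ler0q q0.
  by rewrite mulr_ge0 ?ler0n.
rewrite -deg_covecX_ge0 //; apply: (zX_span_deg_ge0 hk).
pose g : 'rV[R]_n := - map_mx ratr ((d i)%:R *: vvec D e i).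
have ray : ray_fan J (fun i => - map_mx ratr ((d i)%:R *: vvec D e i) : 'rV[R]_n)
    (fun u => exists2 t, 0 <= t & u = t *: g) by right; exists i.
move: (reg _ ray); apply: char_span_mono => m [_ /(_ g)]; rewrite deg_covecX_ge0 // => H.
have : 0 <= \sum_l (m 0 l)%:~R * (1 *: g) 0 l.
  by rewrite scale1r; apply: H; exists 1; rewrite ?scale1r.
by rewrite ev_rayX mul1r pmulr_rge0 ?ler0q // ltr0n dd_gt0.
Qed.

End Toric.
End XSide.

Section ASide.
Variables (k : fieldType) (hk : [pchar k] =i pred0) (n : nat).
Variable D : fixed_data n.
Local Notation d i := (dd D i).
Local Notation form := Defs.form.
Local Notation pairing := Defs.pairing.
Local Notation J := (Iuf D).
Variable e0 : 'I_n -> 'rV[int]_n.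
Hypothesis he0 : is_seed D e0.
Implicit Type e : 'I_n -> 'rV[int]_n.
Implicit Types m : 'rV[rat]_n.

Lemma pairing_Mo_basis i j :
  (d j)%:R * pairing (e0 j) (Mo_basis D e0 i) = (j == i)%:R.
Proof.
have [C EC] := seed_matrix_inverse he0.
set B : 'M[rat]_n := \matrix_(j, l) ((d j)%:R * (e0 j 0 l)%:~R).
have BC : B *m (\matrix_(l, i) ((C l i)%:~R / (d i)%:R)) = 1%:M.
  apply/matrixP => a b; rewrite !mxE.
  have db : (d b)%:R != 0 :> rat by rewrite pnatr_eq0 -lt0n dd_gt0.
  move/matrixP: EC => /(_ a b); rewrite !mxE => /(congr1 (intr : int -> rat)).
  rewrite rmorph_sum => E.
  transitivity ((d a)%:R / (d b)%:R * (a == b)%:R : rat).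
    rewrite -[(a == b)%:R in RHS](_ : (a == b)%:R%:~R = _); last by case: (a == b).
    rewrite -E mulr_sumr; apply: eq_bigr => l _.
    by rewrite !mxE rmorphM /=; ring.
  by case: eqP => [->|_]; rewrite ?mulr0 // mulr1 divff.
have /matrixP /(_ j i) := mulmxV (mulmx1_unit BC).1.
rewrite !mxE => <-; rewrite mulr_sumr; apply: eq_bigr => l _.
by rewrite !mxE mulrA.
Qed.

Lemma No_coordinates x : No D x -> exists c : 'I_n -> int,
  x = \sum_i c i *: ((d i)%:Z *: e0 i).
Proof.
case: he0 => _ _ [_ gen _] /gen [c ->]; exists c.
by apply: eq_bigl => i; rewrite in_setT.
Qed.

Lemma pairing_dd i m : pairing ((d i)%:Z *: e0 i) m = (d i)%:R * pairing (e0 i) m.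
Proof. by rewrite pairingZl. Qed.

Lemma pairing_coordinates (c : 'I_n -> int) i :
  pairing (\sum_j c j *: ((d j)%:Z *: e0 j)) (Mo_basis D e0 i) = (c i)%:~R.
Proof.
rewrite pairing_suml (bigD1 i) //= pairing_dd pairing_Mo_basis eqxx mulr1.
rewrite big1 ?addr0 // => j /negbTE ji.
by rewrite pairing_dd pairing_Mo_basis ji mulr0.
Qed.

Lemma Mo_basis_in_Mo i : in_Mo D (Mo_basis D e0 i).
Proof.
by move=> x /No_coordinates [c ->]; rewrite pairing_coordinates intr_int.
Qed.

(** Coordinates of Mo in the basis dual to (d_i e_i), by which the A-tori become
    tori with character lattice Z^n. *)
Definition Mo_coord m : 'rV[int]_n := \row_i numq ((d i)%:R * pairing (e0 i) m).

(** The covector on Mo given by pairing with y in No: its coordinates are those of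
    y in the basis (d_i e_i) of the root seed. *)
Definition psiA (y : 'rV[int]_n) : 'cV[int]_n :=
  \col_i numq (pairing y (Mo_basis D e0 i)).

Definition phiA (x : 'rV[int]_n) : 'rV[int]_n := Mo_coord (form_vec D x).

Lemma zAE m : zA k D e0 m = zX k (Mo_coord m).
Proof. by rewrite zXE; apply: eq_bigr => i _; rewrite mxE. Qed.

Lemma Mo_coord_int i m : in_Mo D m -> (d i)%:R * pairing (e0 i) m \is a Num.int.
Proof. by move=> /(_ _ (seed_No he0 i)); rewrite pairing_dd. Qed.

Lemma Mo_coord_linear (a : int) m m' : in_Mo D m -> in_Mo D m' ->
  Mo_coord (a%:~R *: m + m') = a *: Mo_coord m + Mo_coord m'.
Proof.
move=> Hm Hm'; apply/rowP => i; rewrite !mxE pairingDr pairingZr mulrDr mulrCA.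
by rewrite numq_linear //; exact: Mo_coord_int.
Qed.

Lemma Mo_coord_basis i : Mo_coord (Mo_basis D e0 i) = delta_mx 0 i.
Proof.
by apply/rowP => j; rewrite !mxE pairing_Mo_basis eqxx /=; case: (j == i).
Qed.

Lemma deg_psiA y m : No D y -> in_Mo D m ->
  (deg (psiA y) (Mo_coord m))%:~R = pairing y m.
Proof.
move=> /No_coordinates [c ->] Hm; rewrite degE rmorph_sum pairing_suml.
apply: eq_bigr => i _; rewrite rmorphM /= !mxE pairing_coordinates numq_int.
by rewrite numqK ?Mo_coord_int // pairing_dd mulrC.
Qed.

Lemma form_vec_in_Mo x : Nuf D x -> in_Mo D (form_vec D x).
Proof. by move=> xN y yo; rewrite pairing_form_vec; exact: form_Nuf_No. Qed.

Lemma phiA_linear (a : int) x y : Nuf D x -> Nuf D y ->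
  phiA (a *: x + y) = a *: phiA x + phiA y.
Proof.
move=> xN yN; rewrite /phiA -Mo_coord_linear; [|exact: form_vec_in_Mo..].
by congr Mo_coord; apply/rowP => i; rewrite !mxE form_linearl.
Qed.

Lemma psiA_linear (a : int) x y : No D x -> No D y ->
  psiA (a *: x + y) = a *: psiA x + psiA y.
Proof.
move=> xo yo; apply/colP => i; rewrite !mxE pairingDl pairingZl numq_linear //.
  exact: Mo_basis_in_Mo.
exact: Mo_basis_in_Mo.
Qed.

Lemma deg_psiA_phiA x y : Nuf D x -> No D y ->
  (deg (psiA y) (phiA x))%:~R = form D x y.
Proof.
by move=> xN yo; rewrite deg_psiA ?pairing_form_vec //; exact: form_vec_in_Mo.
Qed.

Local Notation covecA := (covec D psiA).

Lemma brA_basis e j i : brA D e j (Mo_basis D e0 i) = covecA e j i 0.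
Proof. by rewrite /brA /covec mxE pairingZl. Qed.

Lemma zA_vvec e j : zA k D e0 (vvec D e j) = zX k (phiA (e j)).
Proof. exact: zAE. Qed.

Lemma zA_basis i : zA k D e0 (Mo_basis D e0 i) = Defs.coord k i.
Proof. by rewrite zAE Mo_coord_basis zX_delta. Qed.

Lemma mutA_invE e j (f : torus_field k n) :
  mutA_inv D e0 e j f = scale (exchange k (phiA (e j))) (covecA e j) f.
Proof.
by apply: subst_eq => i; rewrite zA_basis zA_vvec -exchangeE brA_basis.
Qed.

Lemma mutAE e j (f : torus_field k n) :
  mutA D e0 e j f = scale (exchange k (phiA (e j))) (- covecA e j) f.
Proof.
apply: subst_eq => i; rewrite zA_basis zA_vvec -exchangeE brA_basis.
by rewrite [(- covecA e j) i 0]mxE.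
Qed.

Lemma laurentA_laurentX (f : torus_field k n) : laurentX f -> laurentA D e0 f.
Proof.
apply: char_span_ind => [||a x _]; [exact: char_span0 | exact: char_spanD|].
pose m := \sum_i (x 0 i)%:~R *: Mo_basis D e0 i.
have Mo0 : in_Mo D 0.
  by move=> y _; rewrite /Defs.pairing big1 // => i _; rewrite mxE mulr0.
have Hc : Mo_coord 0 = 0.
  by have := Mo_coord_linear (-1) Mo0 Mo0; rewrite scaler0 addr0 scaleN1r addNr.
have [mo <-] : in_Mo D m /\ Mo_coord m = x.
  rewrite [in RHS](row_sum_delta x) /m.
  elim/big_rec2: _ => [|i y1 y2 _ [H1 H2]]; first by split.
  split.
    move=> y yo; rewrite pairingDr pairingZr rpredD ?rpredM ?intr_int //.
      exact: Mo_basis_in_Mo.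
    exact: H1.
  rewrite Mo_coord_linear // ?H2 ?Mo_coord_basis //.
  exact: Mo_basis_in_Mo.
by rewrite -zAE; exact: char_span_char.
Qed.

Lemma deg_covecA_ge0 i q : in_Mo D q ->
  (0 <= deg (covecA e0 i) (Mo_coord q)) = (0 <= pairing (e0 i) q).
Proof.
move=> qM; rewrite -(ler0z rat) deg_psiA //; last exact: seed_No he0 i.
by rewrite pairing_dd pmulr_rge0 // ltr0n dd_gt0.
Qed.

Lemma laurentA_phenomenon q w : in_Mo D q -> vertex D w ->
  (forall i, i \in J -> 0 <= pairing (e0 i) q) ->
  laurentA D e0 (pull_up D (@mutA_inv k n D e0) e0 w (zA k D e0 q)).
Proof.
move=> qM wJ q0; apply: laurentA_laurentX; rewrite zAE.
apply: (@laurent_phenomenon k hk n n D phiA psiA _ _ _ _ _ w e0 _ he0 wJ).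
- exact: phiA_linear.
- by move=> a x y _ xo _ yo; exact: psiA_linear.
- by move=> x y xN _ yo; exact: deg_psiA_phiA.
- by move=> e j f _ _; exact: mutA_invE.
- by move=> i iJ; rewrite deg_covecA_ge0 // q0.
Qed.

Lemma mutAK e j : is_seed D e -> j \in J ->
  cancel (@mutA_inv k n D e0 e j) (@mutA k n D e0 e j).
Proof.
move=> he jJ f; rewrite mutA_invE mutAE.
apply: (scaleK (exchange_neq0 hk _)); apply: of_degree_exchange.
apply: (@deg_seed0 n n D phiA psiA _ e j he jJ).
by move=> x y xN _ yo; exact: deg_psiA_phiA.
Qed.

Lemma H0A_zA q : in_Mo D q -> (forall i, i \in J -> 0 <= pairing (e0 i) q) ->
  H0A D e0 (ratA D e0 (zA k D e0 q)).
Proof.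
move=> qM q0; apply: (glued_section_root (mu := @mutA k n D e0)
  (mu_inv := @mutA_inv k n D e0) mutAK he0) => // w wJ.
exact: laurentA_phenomenon.
Qed.

Section Toric.
Variable R : realType.

Lemma ev_rayA i m t :
  \sum_l ratr (m 0 l) * (t *: (map_mx intr ((d i)%:Z *: e0 i) : 'rV[R]_n)) 0 l
  = t * (d i)%:R * ratr (pairing (e0 i) m).
Proof.
rewrite rmorph_sum mulr_sumr; apply: eq_bigr => l _.
by rewrite !mxE !rmorphM /= ratr_int; ring.
Qed.

Lemma TV_A_regularP q : in_Mo D q ->
  (forall i, i \in J -> 0 <= pairing (e0 i) q) <->
  TV_A_regular R D e0 (zA k D e0 q).
Proof.
move=> qM; split=> [q0 sigma Hs|reg i iJ].
  rewrite -[zA k D e0 q]mul1r -(rmorph1 (@cst k n)); apply: char_span_char.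
  split=> // u; case: Hs => [->->|[i iJ ->] [t t0 ->]].
    by rewrite big1 // => l _; rewrite mxE mulr0.
  rewrite ev_rayA; apply: mulr_ge0; last by rewrite ler0q q0.
  by rewrite mulr_ge0 ?ler0n.
rewrite -deg_covecA_ge0 //; apply: (zX_span_deg_ge0 hk).
pose g : 'rV[R]_n := map_mx intr ((d i)%:Z *: e0 i).
have ray : ray_fan J (fun i => map_mx intr ((d i)%:Z *: e0 i) : 'rV[R]_n)
    (fun u => exists2 t, 0 <= t & u = t *: g) by right; exists i.
have [r [c [m [Pm Eq]]]] := reg _ ray.
exists r, c, (fun j => Mo_coord (m j)); split=> [j|]; last first.
  by rewrite -zAE Eq; apply: eq_bigr => j _; rewrite zAE.
have [mM /(_ g) H] := Pm j; rewrite deg_covecA_ge0 //.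
have : 0 <= \sum_l ratr (m j 0 l) * (1 *: g) 0 l.
  by rewrite scale1r; apply: H; exists 1; rewrite ?scale1r.
by rewrite ev_rayA mul1r pmulr_rge0 ?ler0q // ltr0n dd_gt0.
Qed.

End Toric.
End ASide.

Theorem corollary3p11 (R : realType) (k : fieldType)
    (hk : [pchar k] =i pred0) (n : nat) (D : fixed_data n)
    (e : 'I_n -> 'rV[int]_n) (he : is_seed D e) :
  (forall q : 'rV[rat]_n, in_Mo D q ->
     ((forall i, i \in Iuf D -> 0 <= pairing (e i) q) <->
        TV_A_regular R D e (zA k D e q)) /\
     ((forall i, i \in Iuf D -> 0 <= pairing (e i) q) ->
        (forall w, vertex D w -> laurentA D e (ratA D e (zA k D e q) w)) /\
        H0A D e (ratA D e (zA k D e q)))) /\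
  (forall q : 'rV[int]_n,
     ((forall i, i \in Iuf D -> 0 <= pairing q (- vvec D e i)) <->
        TV_X_regular R D e (zX k q)) /\
     ((forall i, i \in Iuf D -> 0 <= pairing q (- vvec D e i)) ->
        (forall w, vertex D w -> laurentX (ratX D e (zX k q) w)) /\
        H0X D e (ratX D e (zX k q)))).
Proof.
split=> [q qM|q]; split.
- exact: TV_A_regularP.
- by move=> q0; have H := H0A_zA hk he qM q0; split=> //; case: H.
- exact: TV_X_regularP.
- by move=> q0; have H := H0X_zX hk he q0; split=> //; case: H.
Qed.
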